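(* Let $S=\bigoplus_{n\ge 0} S_n$ be a finitely generated standard $\mathbb{N}$-graded algebra over an infinite field $k$ with $\dim S = d >0$. Let $x_1, \ldots, x_d$ be a system of parameters of $S$. Assume that $\mathrm{in}\,x_1, \ldots, \mathrm{in}\,x_d$ is a system of parameters of $S$. Then $$e(x_1,\ldots, x_d; S)= o(x_1)\cdots o(x_d)\, e(S).$$
   Context: Standard graded means that $S$ is generated over $k=S_0$ by elements of degree $1$; $\mathfrak m$ denotes the maximal homogeneous ideal of $S$, and systems of parameters are taken with respect to $\mathfrak m$; their elements need not be homogeneous. For $0\ne x\in S$ write uniquely $x=x_{m_1}+\cdots+x_{m_t}$ with $m_1<\cdots<m_t$ and $0\neq x_{m_i}\in S_{m_i}$; put $\mathrm{in}\,x=x_{m_1}$ and $o(x)=m_1$. $e(x_1,\ldots,x_d;S)$ is the Hilbert–Samuel multiplicity of $S$ with respect to the ideal $(x_1,\ldots,x_d)$, and $e(S)=e(\mathfrak m;S)$. *)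

(* Defs.v *)
From HB Require Import structures.
From mathcomp Require Import all_boot all_order all_algebra.
From mathcomp Require Import generic_quotient ring.
From mathcomp Require Import boolp classical_sets cardinality reals.
From mathcomp Require Import topology normedtype sequences.

Set Implicit Arguments.
Unset Strict Implicit.
Unset Printing Implicit Defensive.

Import Order.TTheory GRing.Theory Num.Theory numFieldNormedType.Exports.
Local Open Scope classical_set_scope.
Local Open Scope ring_scope.

(* [idealr_closed] of MathComp excludes the unit ideal, which is needed here
   (as the top of chains and as the zeroth power). *)
Definition is_ideal (A : comPzRingType) (I : set A) : Prop :=
  [/\ I 0, (forall u v, I u -> I v -> I (u + v))
    & (forall a u, I u -> I (a * u))].

Definition is_prime (A : comPzRingType) (P : set A) : Prop :=
  [/\ is_ideal P, ~ P 1 & (forall u v, P (u * v) -> P u \/ P v)].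

Definition ideal_gen (A : comPzRingType) (X : set A) : set A :=
  [set a | forall I : set A, is_ideal I -> X `<=` I -> I a].

Definition ideal_mul (A : comPzRingType) (I J : set A) : set A :=
  ideal_gen [set a | exists u v, [/\ I u, J v & a = u * v]].

Definition ideal_pow (A : comPzRingType) (I : set A) (n : nat) : set A :=
  iter n (ideal_mul I) [set: A].

Definition radical (A : comPzRingType) (I : set A) : set A :=
  [set a | exists n, I (a ^+ n)].

(* There is a chain c 0 < c 1 < ... < c n of members of F. *)
Definition has_chain (T : Type) (F : set (set T)) (n : nat) : Prop :=
  exists c : nat -> set T,
    (forall i, (i <= n)%N -> F (c i)) /\
    (forall i, (i < n)%N -> c i `<` c i.+1).

Definition max_chain (T : Type) (F : set (set T)) (n : nat) : Prop :=
  has_chain F n /\ forall m, has_chain F m -> (m <= n)%N.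

Definition krull_dim (A : comPzRingType) (d : nat) : Prop :=
  max_chain [set P : set A | is_prime P] d.

(* Length of the A-module A / J, whose submodules are the ideals of A that
   contain J; the value is 0 by convention if the length is infinite. *)
Definition colength (A : comPzRingType) (J : set A) : nat :=
  xget 0%N [set l | max_chain [set I : set A | is_ideal I /\ J `<=` I] l].

(* lim_n d! * length(A / I^n) / n^d, which is the Hilbert-Samuel multiplicity
   when A is a local ring of dimension d and I is primary to its maximal
   ideal. *)
Definition hs_mult (R : realType) (A : comPzRingType) (d : nat) (I : set A)
    : R :=
  limn (fun n : nat =>
    (d`!)%:R * (colength (ideal_pow I n))%:R / n%:R ^+ d : R).

(* The localization is formed with respect to the multiplicative submonoid
   generated by T, so that no side condition on T is needed; if T is the
   complement of a prime ideal, this submonoid is T itself. Fractions a / s and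
   b / t are identified when u * (a * t) = u * (b * s) for some denominator
   u. *)
Section Localization.
Local Open Scope quotient_scope.
Variables (A : comNzRingType) (T : set A).

Definition submonoid_gen : set A :=
  [set a | forall M : set A,
    M 1 -> (forall u v, M u -> M v -> M (u * v)) -> T `<=` M -> M a].

Lemma submonoid_gen1 : submonoid_gen 1.
Proof. by move=> M. Qed.

Lemma submonoid_genM u v :
  submonoid_gen u -> submonoid_gen v -> submonoid_gen (u * v).
Proof. by move=> hu hv M M1 MM TM; apply: (MM); [exact: hu|exact: hv]. Qed.

Definition denom : choiceType := {s : A | `[< submonoid_gen s >]}.

Definition mk_denom s (h : submonoid_gen s) : denom := exist _ s (asboolT h).

Lemma denomP (s : denom) : submonoid_gen (sval s).
Proof. exact: asboolW (svalP s). Qed.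

Definition denom1 : denom := mk_denom submonoid_gen1.

Definition denomM (s t : denom) : denom :=
  mk_denom (submonoid_genM (denomP s) (denomP t)).

Definition fraction : choiceType := (A * denom)%type.

Definition frac_eq (x y : fraction) : bool :=
  `[< exists u : denom, sval u * (x.1 * sval y.2) = sval u * (y.1 * sval x.2) >].

Lemma frac_eq_refl : reflexive frac_eq.
Proof. by move=> x; apply/asboolP; exists denom1. Qed.

Lemma frac_eq_sym : symmetric frac_eq.
Proof. by move=> x y; apply/asboolP/asboolP => -[u hu]; exists u. Qed.

Lemma frac_eq_trans : transitive frac_eq.
Proof.
move=> y x z /asboolP[u hu] /asboolP[v hv]; apply/asboolP.
exists (denomM (denomM u v) y.2) => /=.
have -> : sval u * sval v * sval y.2 * (x.1 * sval z.2) =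
  sval v * sval z.2 * (sval u * (x.1 * sval y.2)) by ring.
have -> : sval u * sval v * sval y.2 * (z.1 * sval x.2) =
  sval u * sval x.2 * (sval v * (z.1 * sval y.2)) by ring.
by rewrite hu -hv; ring.
Qed.

Canonical frac_equiv := EquivRel frac_eq frac_eq_refl frac_eq_sym frac_eq_trans.

Definition loc := {eq_quot frac_eq}.

HB.instance Definition _ := Choice.on loc.
HB.instance Definition _ : EqQuotient _ frac_eq loc := EqQuotient.on loc.

Definition frac_add (x y : fraction) : fraction :=
  (x.1 * sval y.2 + y.1 * sval x.2, denomM x.2 y.2).
Definition frac_opp (x : fraction) : fraction := (- x.1, x.2).
Definition frac_mul (x y : fraction) : fraction :=
  (x.1 * y.1, denomM x.2 y.2).

Definition to_loc (a : A) : loc := \pi_loc (a, denom1).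
Definition loc_add := lift_op2 loc frac_add.
Definition loc_opp := lift_op1 loc frac_opp.
Definition loc_mul := lift_op2 loc frac_mul.

Lemma repr_loc (x : fraction) : exists u : denom,
  sval u * (x.1 * sval (repr (\pi_loc x)).2) =
  sval u * ((repr (\pi_loc x)).1 * sval x.2).
Proof.
have : x == repr (\pi_loc x) %[mod loc] by rewrite reprK.
by rewrite eqmodE => /asboolP.
Qed.

Lemma pi_loc_add : {morph \pi_loc : x y / frac_add x y >-> loc_add x y}.
Proof.
move=> x y; unlock loc_add; apply/eqmodP/asboolP.
have [u hu] := repr_loc x; have [v hv] := repr_loc y.
move: (repr _) hu (repr _) hv => x' hu y' hv; exists (denomM u v) => /=.
transitivity (sval v * (sval y.2 * sval y'.2) * (sval u * (x.1 * sval x'.2)) +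
  sval u * (sval x.2 * sval x'.2) * (sval v * (y.1 * sval y'.2))); first by ring.
by rewrite hu hv; ring.
Qed.
Canonical pi_loc_add_morph := PiMorph2 pi_loc_add.

Lemma pi_loc_opp : {morph \pi_loc : x / frac_opp x >-> loc_opp x}.
Proof.
move=> x; unlock loc_opp; apply/eqmodP/asboolP.
have [u hu] := repr_loc x; exists u => /=.
by rewrite !mulNr !mulrN hu.
Qed.
Canonical pi_loc_opp_morph := PiMorph1 pi_loc_opp.

Lemma pi_loc_mul : {morph \pi_loc : x y / frac_mul x y >-> loc_mul x y}.
Proof.
move=> x y; unlock loc_mul; apply/eqmodP/asboolP.
have [u hu] := repr_loc x; have [v hv] := repr_loc y.
move: (repr _) hu (repr _) hv => x' hu y' hv; exists (denomM u v) => /=.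
transitivity ((sval u * (x.1 * sval x'.2)) * (sval v * (y.1 * sval y'.2))).
  by ring.
by rewrite hu hv; ring.
Qed.
Canonical pi_loc_mul_morph := PiMorph2 pi_loc_mul.

Lemma loc_eqP (x y : fraction) :
  x.1 * sval y.2 = y.1 * sval x.2 -> \pi_loc x = \pi_loc y.
Proof. by move=> h; apply/eqmodP/asboolP; exists denom1; rewrite h. Qed.

Lemma loc_addA : associative loc_add.
Proof.
elim/quotW=> x; elim/quotW=> y; elim/quotW=> z; rewrite !piE.
by apply: loc_eqP => /=; ring.
Qed.

Lemma loc_addC : commutative loc_add.
Proof.
by elim/quotW=> x; elim/quotW=> y; rewrite !piE; apply: loc_eqP => /=; ring.
Qed.

Lemma loc_add0 : left_id (to_loc 0) loc_add.
Proof.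
by elim/quotW=> x; rewrite /to_loc !piE; apply: loc_eqP => /=; ring.
Qed.

Lemma loc_addN : left_inverse (to_loc 0) loc_opp loc_add.
Proof.
by elim/quotW=> x; rewrite /to_loc !piE; apply: loc_eqP => /=; ring.
Qed.

HB.instance Definition _ :=
  GRing.isZmodule.Build loc loc_addA loc_addC loc_add0 loc_addN.

Lemma loc_mulA : associative loc_mul.
Proof.
elim/quotW=> x; elim/quotW=> y; elim/quotW=> z; rewrite !piE.
by apply: loc_eqP => /=; ring.
Qed.

Lemma loc_mulC : commutative loc_mul.
Proof.
by elim/quotW=> x; elim/quotW=> y; rewrite !piE; apply: loc_eqP => /=; ring.
Qed.

Lemma loc_mul1 : left_id (to_loc 1) loc_mul.
Proof.
by elim/quotW=> x; rewrite /to_loc !piE; apply: loc_eqP => /=; ring.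
Qed.

Lemma loc_mulD : left_distributive loc_mul loc_add.
Proof.
elim/quotW=> x; elim/quotW=> y; elim/quotW=> z; rewrite !piE.
by apply: loc_eqP => /=; ring.
Qed.

HB.instance Definition _ :=
  GRing.Zmodule_isComPzRing.Build loc loc_mulA loc_mulC loc_mul1 loc_mulD.

End Localization.

(* The extension of the ideal I of A to the local ring A_m. *)
Definition ext (A : comNzRingType) (m I : set A) : set (loc (~` m)) :=
  ideal_gen (@to_loc A (~` m) @` I).
Arguments ext {A} m I _.

Section Graded.
Variables (k : fieldType) (S : comAlgType k).

Definition is_subalgebra (B : set S) : Prop :=
  [/\ B 1, (forall (c : k) u, B u -> B (c *: u)),
      (forall u v, B u -> B v -> B (u + v))
    & (forall u v, B u -> B v -> B (u * v))].

Definition alg_gen (X : set S) : set S :=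
  [set a | forall B : set S, is_subalgebra B -> X `<=` B -> B a].

Definition fin_gen_algebra : Prop := exists s : seq S, alg_gen [set` s] = setT.

Variable G : nat -> set S.

Definition hom_decomp (x : S) (a : nat -> S) : Prop :=
  (forall i, G i (a i)) /\
  exists N, (forall i, (N <= i)%N -> a i = 0) /\ x = \sum_(i < N) a i.

Definition standard_graded : Prop :=
  [/\ (forall n, [/\ G n 0, (forall u v, G n u -> G n v -> G n (u + v))
                   & (forall (c : k) u, G n u -> G n (c *: u))]),
      (forall i j u v, G i u -> G j v -> G (i + j)%N (u * v)),
      (forall x, exists! a, hom_decomp x a),
      G 0%N = range (fun c : k => c%:A)
    & alg_gen (G 1%N) = setT].

Definition hom_comp (n : nat) (x : S) : S :=
  xget 0 [set y | exists2 a, hom_decomp x a & y = a n].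

(* o(x), with o(0) = 0 by convention *)
Definition ord (x : S) : nat :=
  xget 0%N [set n | hom_comp n x <> 0 /\
                    forall i, (i < n)%N -> hom_comp i x = 0].

(* in x, with in 0 = 0 by convention *)
Definition init (x : S) : S := hom_comp (ord x) x.

Definition irrelevant : set S :=
  ideal_gen (\bigcup_(n in [set n | (0 < n)%N]) G n).

(* x_1, ..., x_d is a system of parameters of the local ring at the irrelevant
   ideal, d being the dimension of S: it generates there an ideal primary to
   the maximal ideal. In particular every x_i lies in the irrelevant ideal. *)
Definition sop (d : nat) (x : 'I_d -> S) : Prop :=
  krull_dim S d /\
  radical (ext irrelevant (ideal_gen (range x))) = ext irrelevant irrelevant.

(* e(I; S), computed in the local ring of S at the irrelevant ideal m. If I
   contains a power of m, then S / I^n is already m-local, so that this is also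
   the multiplicity defined by the lengths of the S-modules S / I^n. The
   dimension d of S is also that of the local ring. *)
Definition multiplicity (R : realType) (d : nat) (I : set S) : R :=
  hs_mult R d (ext irrelevant I).

End Graded.

(* Main.v *)
Require Import Defs.
From mathcomp Require Import all_boot all_order all_algebra.
From mathcomp Require Import boolp classical_sets cardinality reals.
From mathcomp Require Import generic_quotient ring lra zify.
From mathcomp Require Import topology normedtype sequences.

Set Implicit Arguments.
Unset Strict Implicit.
Unset Printing Implicit Defensive.

Import Order.TTheory GRing.Theory Num.Theory numFieldNormedType.Exports.
Local Open Scope classical_set_scope.
Local Open Scope ring_scope.

(* For positive weights w let C_w(n) be the ideal generated by the monomials
   x^s with w.s >= n, and let B(b) be the colength of (x_1^b, ..., x_d^b).
   Covering the exponents by cubes of side b, each of which contributes at most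
   B(b) to a length, and counting cubes gives, for every system of parameters,
     d! w_1...w_d length(S / C_w(n)) / n^d --> inf_b B(b) / b^d =: r,
   whatever w is. For w = (1, ..., 1), C_w(n) is the n-th power of the parameter
   ideal, so r is its multiplicity. For w_i = o(x_i), the assumption on initial
   forms gives m^(n+c) <= C_w(n) <= m^n locally for a constant c, so that
   r / (o(x_1)...o(x_d)) is e(S). If some o(x_i) is 0 then x_i = 0, C_w does not
   depend on w_i, and therefore r = 0. *)

(** * Ideals and lengths *)

(** Convergence of the limit that defines the multiplicity is part of what is proved, and neither
    Hilbert polynomials nor associated graded rings enter. Length is controlled only by
    subadditivity along filtrations, which by itself yields nothing but upper bounds. The lower
    bound comes from a complement: the box ideal of side $bt$ has colength $B(bt)\ge r(bt)^d$
    because $r$ is an infimum; the cubes of side $b$ in that box which reach weight $n$ account for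
    at most $B(b)$ each; whatever length is left must be found in $S/C_w(n)$. If $b$ is chosen with
    $B(b)/b^d$ close to $r$, the loss on the discarded cubes is small compared with $n^d$, and the
    two bounds meet. The second difficulty is that the $x_i$ are not homogeneous while the grading
    lives on $S$ and the lengths on its localization. A local relation is made homogeneous by
    clearing a denominator and taking one graded component: the denominator then enters only through
    its nonzero constant term. *)

Section Ideals.
Variable A : comPzRingType.
Implicit Types (I J K B : set A) (X Y : set A) (u v a : A) (us : seq A).

Lemma idealT : is_ideal [set: A].
Proof. by []. Qed.

Lemma ideal_gen_ideal X : is_ideal (ideal_gen X).
Proof.
split=> [I [] //|u v hu hv I idI XI|a u hu I idI XI].
  by case: (idI) => _ + _; apply; [exact: hu|exact: hv].
by case: (idI) => _ _; apply; exact: hu.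
Qed.

Lemma sub_ideal_gen X : X `<=` ideal_gen X.
Proof. by move=> a Xa I _; apply. Qed.

Lemma ideal_gen_min X I : is_ideal I -> X `<=` I -> ideal_gen X `<=` I.
Proof. by move=> idI XI a; apply. Qed.

Lemma ideal_gen_mono X Y : X `<=` Y -> ideal_gen X `<=` ideal_gen Y.
Proof.
move=> XY; apply: ideal_gen_min; first exact: ideal_gen_ideal.
by move=> a /XY; exact: sub_ideal_gen.
Qed.

Lemma ideal_mull I a u : is_ideal I -> I u -> I (a * u).
Proof. by case=> _ _; apply. Qed.

Lemma ideal_mulr I a u : is_ideal I -> I u -> I (u * a).
Proof. by rewrite mulrC; exact: ideal_mull. Qed.

Lemma ideal_add I u v : is_ideal I -> I u -> I v -> I (u + v).
Proof. by case=> _ + _; apply. Qed.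

Lemma ideal_opp I u : is_ideal I -> I u -> I (- u).
Proof. by move=> idI Iu; rewrite -mulN1r; exact: ideal_mull. Qed.

Lemma ideal_sum (T : Type) (r : seq T) (P : pred T) (F : T -> A) I :
  is_ideal I -> (forall i, P i -> I (F i)) -> I (\sum_(i <- r | P i) F i).
Proof.
move=> idI IF; apply: (big_ind I) => //; first by case: idI.
by move=> u v; exact: ideal_add.
Qed.

Lemma ideal_one I : is_ideal I -> I 1 -> I = setT.
Proof.
move=> idI I1; apply/seteqP; split=> // a _.
by rewrite -[a]mulr1; exact: ideal_mull.
Qed.

(** For fixed [w] the condition [K (a * w)] defines an ideal in [a], so membership can be tested on
    generators in one factor at a time. *)
Lemma ideal_mul_gen_sub X Y K : is_ideal K ->
  (forall u v, X u -> Y v -> K (u * v)) ->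
  ideal_mul (ideal_gen X) (ideal_gen Y) `<=` K.
Proof.
move=> idK XYK; apply: ideal_gen_min => // _ [u [v [hu hv ->]]].
have idc w : is_ideal [set a | K (a * w)].
  split=> [|a b|a b] /=; first by rewrite mul0r; case: idK.
    by move=> ha hb; rewrite mulrDl; exact: ideal_add.
  by rewrite -mulrA; exact: ideal_mull.
apply: (hu _ (idc v)) => u0 Xu0 /=; rewrite mulrC.
by apply: (hv _ (idc u0)) => v0 Yv0 /=; rewrite mulrC; exact: XYK.
Qed.

Lemma ideal_mul_mem I J u v : I u -> J v -> ideal_mul I J (u * v).
Proof. by move=> Iu Jv; apply: sub_ideal_gen; exists u, v. Qed.

Lemma ideal_mul_sub I J K : is_ideal K ->
  (forall u v, I u -> J v -> K (u * v)) -> ideal_mul I J `<=` K.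
Proof.
by move=> idK IJK; apply: ideal_gen_min => // _ [u [v [Iu Jv ->]]]; exact: IJK.
Qed.

Lemma ideal_pow_ideal I n : is_ideal (ideal_pow I n).
Proof. by case: n => [|n]; [exact: idealT|exact: ideal_gen_ideal]. Qed.

Lemma ideal_powS_sub I n : ideal_pow I n.+1 `<=` ideal_pow I n.
Proof.
have idp := ideal_pow_ideal I n.
by apply: ideal_mul_sub => // u v _; exact: ideal_mull.
Qed.

Lemma ideal_pow_le I m n : (m <= n)%N -> ideal_pow I n `<=` ideal_pow I m.
Proof.
move=> /subnK <-; elim: (n - m)%N => [//|l IH].
by rewrite addSn; exact: subset_trans (@ideal_powS_sub _ _) IH.
Qed.

Lemma ideal_pow_mono I J n : I `<=` J -> ideal_pow I n `<=` ideal_pow J n.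
Proof.
move=> IJ; elim: n => [//|n IH]; apply: ideal_gen_mono => _ [u [v [hu hv ->]]].
by exists u, v; split=> //; [exact: IJ|exact: IH].
Qed.

Definition ideal_sum2 I J : set A :=
  [set a | exists u v, [/\ I u, J v & a = u + v]].

Lemma ideal_sum2_ideal I J : is_ideal I -> is_ideal J -> is_ideal (ideal_sum2 I
  J).
Proof.
move=> idI idJ; split.
- by exists 0, 0; rewrite addr0; case: idI; case: idJ.
- move=> _ _ [u [v [Iu Jv ->]]] [u' [v' [Iu' Jv' ->]]].
  by exists (u + u'), (v + v'); split; [exact: ideal_add..|ring].
- move=> a _ [u [v [Iu Jv ->]]].
  by exists (a * u), (a * v); split; [exact: ideal_mull..|ring].
Qed.

Lemma ideal_sum2l I J : is_ideal J -> I `<=` ideal_sum2 I J.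
Proof. by move=> [J0 _ _] u Iu; exists u, 0; rewrite addr0. Qed.

Lemma ideal_sum2r I J : is_ideal I -> J `<=` ideal_sum2 I J.
Proof. by move=> [I0 _ _] u Ju; exists 0, u; rewrite add0r. Qed.

(** A product of [m + n] factors [w + w'] expands into terms having at least [m] factors from [I] or
    at least [n] from [J]. The expansion is done one factor at a time, replacing [K] by its colon
    with [w] or [w']; hence the induction is over all [K]. *)
Lemma ideal_pow_sum2 I J K m n : is_ideal K ->
  ideal_pow I m `<=` K -> ideal_pow J n `<=` K ->
  ideal_pow (ideal_sum2 I J) (m + n) `<=` K.
Proof.
move=> + ImK JnK => idK; elim: m n K idK ImK JnK => [|m IHm] n K idK ImK JnK.
  by rewrite (_ : K = setT) //; apply: ideal_one => //; exact: ImK.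
elim: n K idK ImK JnK => [|n IHn] K idK ImK JnK.
  by rewrite (_ : K = setT) //; apply: ideal_one => //; exact: JnK.
have idc w : is_ideal [set a | K (w * a)].
  split=> [|a b|a b] /=; first by rewrite mulr0; case: idK.
    by move=> ha hb; rewrite mulrDr; exact: ideal_add.
  by rewrite mulrCA; exact: ideal_mull.
apply: ideal_mul_sub => // _ v [w [w' [Iw Jw' ->]]] hv.
rewrite mulrDl; apply: ideal_add => //.
- apply: (IHm n.+1 [set a | K (w * a)]) hv => //.
    by move=> a ha /=; apply: ImK; exact: ideal_mul_mem.
  by move=> a /JnK; exact: ideal_mull.
- have {}hv : ideal_pow (ideal_sum2 I J) (m.+1 + n) v by rewrite addSnnS.
  apply: (IHn [set a | K (w' * a)]) hv => //.
    by move=> a /ImK; exact: ideal_mull.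
  by move=> a ha /=; apply: JnK; exact: ideal_mul_mem.
Qed.

Lemma ideal_gen1_pow u n K : is_ideal K -> K (u ^+ n) ->
  ideal_pow (ideal_gen [set u]) n `<=` K.
Proof.
elim: n K => [|n IH] K idK; first by move=> /(ideal_one idK) ->.
move=> Kun; apply: ideal_mul_sub => // v w hv hw.
have idc a : is_ideal [set b | K (b * a)].
  split=> [|b c|b c] /=; first by rewrite mul0r; case: idK.
    by move=> hb hc; rewrite mulrDl; exact: ideal_add.
  by rewrite -mulrA; exact: ideal_mull.
apply: (hv _ (idc w)) => _ -> /=; rewrite mulrC.
by apply: (IH _ (idc u)) hw => /=; rewrite -exprSr.
Qed.

(** A finitely generated ideal inside the radical of [K] has a power inside [K]. Splitting off one
    generator at a time, the exponents add up by [ideal_pow_sum2]. *)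
Lemma fg_radical_pow us K : is_ideal K ->
  (forall u, u \in us -> exists n, K (u ^+ n)) ->
  exists n, ideal_pow (ideal_gen [set` us]) n `<=` K.
Proof.
move=> idK; elim: us => [|u us IH] Kus.
  exists 1%N; apply: ideal_mul_sub => // v w hv _; apply: ideal_mulr => //.
  by apply: (hv K idK) => a.
have [n Kn] := IH (fun v hv => Kus v (@mem_behead _ (u :: us) v hv)).
have [m Km] := Kus u (mem_head _ _).
exists (m + n)%N; apply: subset_trans
  (ideal_pow_sum2 idK (ideal_gen1_pow idK Km) Kn).
apply: ideal_pow_mono; apply: ideal_gen_min.
  by apply: ideal_sum2_ideal; exact: ideal_gen_ideal.
move=> v /=; rewrite inE => /orP[/eqP ->|vus].
  by apply: ideal_sum2l; [exact: ideal_gen_ideal|exact: sub_ideal_gen].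
by apply: ideal_sum2r; [exact: ideal_gen_ideal|exact: sub_ideal_gen].
Qed.

End Ideals.

(** * Length bounds through chains of ideals *)

Section Length.
Variable A : comPzRingType.
Implicit Types (I J K B : set A) (u : A) (us : seq A).

Definition seg J K : set (set A) :=
  [set I | [/\ is_ideal I, J `<=` I & I `<=` K]].

(** The module [K / J] has length at most [n]. A bound, unlike the number [colength], cannot confuse
    infinite length with length 0. *)
Definition len_le J K n := forall m, has_chain (seg J K) m -> (m <= n)%N.

Lemma has_chain_mono (F F' : set (set A)) n :
  F `<=` F' -> has_chain F n -> has_chain F' n.
Proof. by move=> FF' [c [cF ltc]]; exists c; split=> // i /cF /FF'. Qed.

Lemma seg_mono J K J' K' : J' `<=` J -> K `<=` K' -> seg J K `<=` seg J' K'.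
Proof. by move=> J'J KK' I [idI JI IK]; split=> // a;
  [move/J'J/JI|move/IK/KK']. Qed.

Lemma len_le_mono J K J' K' n :
  J `<=` J' -> K' `<=` K -> len_le J K n -> len_le J' K' n.
Proof. by move=> JJ' K'K h m /(has_chain_mono (seg_mono JJ' K'K));
  exact: h. Qed.

Lemma has_chainS J K K' n : is_ideal K' -> J `<=` K' -> K `<` K' ->
  has_chain (seg J K) n -> has_chain (seg J K') n.+1.
Proof.
move=> idK' JK' KK' [c [cJK ltc]].
exists (fun i => if (i <= n)%N then c i else K'); split=> i lei.
  case: ifP => [/cJK|_]; last by split.
  by move=> [idc Jc cK]; split=> //; case: KK' => KK' _;
    exact: subset_trans KK'.
rewrite (lei : (i <= n)%N); case: ltnP => [|ni]; first exact: ltc.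
have ->: i = n by apply/eqP; rewrite eqn_leq ni -ltnS lei.
have [_ _ cK] := cJK n (leqnn n).
case: KK' => KK' nK'K; split; first exact: subset_trans KK'.
by move=> K'c; apply: nK'K; exact: subset_trans cK.
Qed.

Lemma has_chain0 J K : is_ideal J -> J `<=` K -> has_chain (seg J K) 0.
Proof. by move=> idJ JK; exists (fun=> J); split=> // i _; split. Qed.

(* By the modular law, every strict step of a chain stays strict after
   intersecting with I or after adding I. *)
Lemma len_le_trans J I K a b : is_ideal I -> J `<=` I -> I `<=` K ->
  is_ideal J -> is_ideal K ->
  len_le J I a -> len_le I K b -> len_le J K (a + b).
Proof.
move=> idI JI IK idJ idK lea leb m [c [cJK ltc]].
have idcap i : (i <= m)%N -> is_ideal (c i `&` I).
  move=> /cJK[[c0 cD cM] _ _]; have [I0 ID IM] := idI.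
  by split=> [//|u v [? ?] [? ?]|u v [? ?]]; split; auto.
have idsum i : (i <= m)%N -> is_ideal (ideal_sum2 (c i) I).
  by move=> /cJK[? _ _]; exact: ideal_sum2_ideal.
have main i : (i <= m)%N -> exists p q, [/\ (i <= p + q)%N,
    has_chain (seg J (c i `&` I)) p & has_chain (seg I (ideal_sum2 (c i) I)) q].
  elim: i => [|i IH] im.
    have [idc Jc _] := cJK 0%N im.
    exists 0%N, 0%N; split=> //; apply: has_chain0 => //;
      first by move=> u Ju; split; auto.
    exact: ideal_sum2r.
  have [p [q [ipq hp hq]]] := IH (ltnW im).
  have [sub nsub] := ltc _ im.
  have [idc' Jc' _] := cJK _ im; have [idc Jc _] := cJK _ (ltnW im).
  have subI : c i `&` I `<=` c i.+1 `&` I by move=> u [/sub].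
  have subS : ideal_sum2 (c i) I `<=` ideal_sum2 (c i.+1) I.
    by move=> _ [u [v [/sub cu Iv ->]]]; exists u, v.
  have [eqI|neI] := pselect (c i.+1 `&` I `<=` c i `&` I); last first.
    exists p.+1, q; rewrite addSn; split=> //.
      by apply: has_chainS hp => //; [exact: idcap|by move=> u Ju; split; auto].
    by apply: has_chain_mono hq; exact: seg_mono.
  have [eqS|neS] := pselect (ideal_sum2 (c i.+1) I `<=` ideal_sum2 (c i) I);
    last first.
    exists p, q.+1; rewrite addnS; split=> //.
      by apply: has_chain_mono hp; exact: seg_mono.
    apply: has_chainS hq => //; [exact: idsum|exact: ideal_sum2r].
  case: nsub => u cu.
  have [|v [w [cv Iw uvw]]] := eqS u; first exact: ideal_sum2l.
  rewrite uvw; apply: ideal_add => //.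
  have /eqI [] // : (c i.+1 `&` I) w.
  split=> //; have -> : w = u - v by rewrite uvw; ring.
  by apply: ideal_add => //; apply: ideal_opp => //; exact: sub.
have [p [q [mpq hp hq]]] := main m (leqnn m).
apply: (leq_trans mpq); apply: leq_add.
  by apply: lea; apply: has_chain_mono hp; apply: seg_mono => // u [].
apply: leb; apply: has_chain_mono hq;
  apply: seg_mono => // _ [u [v [cu Iv ->]]].
have [_ _ cK] := cJK m (leqnn m).
by apply: ideal_add => //; [exact: cK|exact: IK].
Qed.

Definition ideal_colon I u : set A := [set a | I (a * u)].

Lemma ideal_colon_ideal I u : is_ideal I -> is_ideal (ideal_colon I u).
Proof.
move=> idI; split=> [|a b|a b]; rewrite /ideal_colon /=.
- by rewrite mul0r; case: idI.
- by rewrite mulrDl; exact: ideal_add.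
- by rewrite -mulrA; exact: ideal_mull.
Qed.

Definition adjoin J u : set A := [set a | exists j b, J j /\ a = j + b * u].

Lemma adjoin_ideal J u : is_ideal J -> is_ideal (adjoin J u).
Proof.
move=> idJ; split.
- by exists 0, 0; split; [case: idJ|ring].
- move=> _ _ [j [b [Jj ->]]] [j' [b' [Jj' ->]]].
  by exists (j + j'), (b + b'); split; [exact: ideal_add|ring].
- move=> a _ [j [b [Jj ->]]].
  by exists (a * j), (a * b); split; [exact: ideal_mull|ring].
Qed.

Lemma sub_adjoin J u : J `<=` adjoin J u.
Proof. by move=> j Jj; exists j, 0; split=> //; ring. Qed.

Lemma mem_adjoin J u : is_ideal J -> adjoin J u u.
Proof. by move=> [J0 _ _]; exists 0, 1; split=> //; ring. Qed.

(** Multiplication by [u] maps [A / B] onto [adjoin J u / J]. In terms of chains, taking the colon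
    by [u] is strictly monotone on the ideals between [J] and [adjoin J u]. *)
Lemma len_le_adjoin B J u c : is_ideal J -> len_le B setT c ->
  (forall b, B b -> J (b * u)) -> len_le J (adjoin J u) c.
Proof.
move=> idJ lenB BuJ m [C [CJK ltC]]; apply: lenB.
exists (fun i => ideal_colon (C i) u); split=> i im.
  have [idC JC _] := CJK _ im.
  by split=> // [|b /BuJ /JC //]; exact: ideal_colon_ideal.
have [sub nsub] := ltC _ im; split=> [a /sub //|eqc].
have [idC JC _] := CJK _ (ltnW im); have [idC' JC' CK'] := CJK _ im.
apply: nsub => e Ce; have [j [b [Jj def_e]]] := CK' _ Ce; rewrite def_e.
apply: ideal_add => //; first exact: JC.
apply: eqc; rewrite /ideal_colon /=.
have -> : b * u = e - j by rewrite def_e; ring.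
by apply: ideal_add => //; apply: ideal_opp => //; exact: JC'.
Qed.

Fixpoint adjoins J us : set A :=
  if us is u :: us' then adjoin (adjoins J us') u else J.

Lemma adjoins_ideal J us : is_ideal J -> is_ideal (adjoins J us).
Proof. by move=> idJ; elim: us => //= u us; exact: adjoin_ideal. Qed.

Lemma sub_adjoins J us : J `<=` adjoins J us.
Proof.
by elim: us => //= u us IH; exact: subset_trans IH (@sub_adjoin _ _).
Qed.

Lemma mem_adjoins J us u : is_ideal J -> u \in us -> adjoins J us u.
Proof.
move=> idJ; elim: us => //= v us IH; rewrite inE => /orP[/eqP ->|/IH].
  by apply: mem_adjoin; exact: adjoins_ideal.
exact: sub_adjoin.
Qed.

Lemma len_le_refl J : len_le J J 0.
Proof.
case=> [//|m] [c [cJ ltc]]; have [_ nsub] := ltc 0%N isT.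
have [_ Jc _] := cJ 0%N isT; have [_ _ cJ'] := cJ 1%N isT.
by case: nsub => u /cJ'; exact: Jc.
Qed.

(** Each generator adds a cyclic module killed by [B], hence at most [c] to the length. As [adjoins]
    adds the head of the list last, it is the tail [ts2] that is already present when [f t] is
    added. *)
Lemma len_le_adjoins (T : Type) (f : T -> A) B J (ts : seq T) c :
  is_ideal J -> len_le B setT c ->
  (forall ts1 t ts2, ts = ts1 ++ t :: ts2 ->
     forall b, B b -> adjoins J (map f ts2) (b * f t)) ->
  len_le J (adjoins J (map f ts)) (size ts * c).
Proof.
move=> idJ lenB; elim: ts => [_|t ts IH hts]; first exact: len_le_refl.
rewrite mulSn addnC; have idts := adjoins_ideal (map f ts) idJ.
apply: (@len_le_trans _ (adjoins J (map f ts))) => //.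
- exact: sub_adjoins.
- exact: sub_adjoin.
- exact: adjoin_ideal.
- by apply: IH => ts1 v ts2 def_ts; apply: (hts (t :: ts1)); rewrite def_ts.
- by apply: len_le_adjoin lenB _ => //; exact: (hts [::]).
Qed.

(** A bound on chains makes a maximal length exist, so the default value in [colength] is not
    taken. *)
Lemma colength_max_chain J n : is_ideal J -> len_le J setT n ->
  max_chain [set I : set A | is_ideal I /\ J `<=` I] (colength J).
Proof.
move=> idJ lenJ; rewrite /colength; case: xgetP => [l -> //|noP].
have segE : seg J setT = [set I : set A | is_ideal I /\ J `<=` I].
  by apply/seteqP; split=> [I [? ? _]|I [? ?]]; split.
have ex0 : exists m, `[< has_chain (seg J setT) m >].
  by exists 0%N; apply/asboolP; exact: has_chain0.
have ub m : `[< has_chain (seg J setT) m >] -> (m <= n)%N by move/asboolP/lenJ.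
case: (ex_maxnP ex0 ub) => m /asboolP hm mmax; case: (noP m).
rewrite -segE; split=> // p hp; apply: mmax; exact/asboolP.
Qed.

Definition finite_colength J := exists n, len_le J setT n.

Lemma len_le_colength J : is_ideal J -> finite_colength J ->
  len_le J setT (colength J).
Proof.
move=> idJ [n lenJ] m hm; have [_] := colength_max_chain idJ lenJ; apply.
by apply: has_chain_mono hm => I [].
Qed.

Lemma colength_le J n : is_ideal J -> len_le J setT n -> (colength J <= n)%N.
Proof.
move=> idJ lenJ; have [h _] := colength_max_chain idJ lenJ; apply: lenJ.
by apply: has_chain_mono h => I [].
Qed.

Lemma finite_colength_sub J J' : J `<=` J' -> finite_colength J ->
  finite_colength J'.
Proof. by move=> JJ' [n lenJ]; exists n; exact: len_le_mono lenJ. Qed.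

Lemma colength_anti J J' : is_ideal J -> is_ideal J' -> J `<=` J' ->
  finite_colength J -> (colength J' <= colength J)%N.
Proof.
move=> idJ idJ' JJ' finJ; apply: colength_le => //.
exact: len_le_mono (len_le_colength idJ finJ).
Qed.

End Length.

(** * Counting exponents *)

Section Counting.
Local Open Scope nat_scope.
Implicit Types (d m n t w : nat) (f : nat -> nat) (s : seq nat).

(** Discrete mean value estimate: the derivative term [d.+1 * w * t ^ d] dominates the backward
    difference of the power with step [w], and by the next lemma it is dominated by the forward
    difference. *)
Lemma expn_subl_bound d w t : t ^ d.+1 <= d.+1 * w * t ^ d + (t - w) ^ d.+1.
Proof.
elim: d => [|d IH]; first by rewrite !expn1 expn0; lia.
rewrite expnS (leq_trans (leq_mul (leqnn t) IH)) // mulnDr mulnCA -expnS.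
have h1 : (t - w) ^ d.+1 <= t ^ d.+1 by rewrite leq_exp2r // leq_subr.
have h2 : t * (t - w) ^ d.+1 <= (w + (t - w)) * (t - w) ^ d.+1.
  by rewrite leq_mul2r; apply/orP; right; lia.
rewrite mulnDl -expnS in h2.
have h3 : w * (t - w) ^ d.+1 <= w * t ^ d.+1 by rewrite leq_mul2l h1 orbT.
have -> : d.+2 * w = d.+1 * w + w by rewrite mulSn addnC.
rewrite mulnDl; lia.
Qed.

Lemma expn_addl_bound d w t : d.+1 * w * t ^ d + t ^ d.+1 <= (t + w) ^ d.+1.
Proof.
elim: d => [|d IH]; first by rewrite !expn1 expn0; lia.
rewrite [leqRHS]expnS (leq_trans _ (leq_mul (leqnn (t + w)) IH)) //.
rewrite !(expnS t) -(addn1 d.+1); move: (t ^ d) (d.+1) => X e.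
apply: leq_trans (leq_addr (w * (e * w * X)) _) _.
by apply: eq_leq; ring.
Qed.

Lemma sum_expn_lower d w m f : (forall t, 0 < t -> t ^ d <= f t) -> 0 < w ->
  m ^ d.+1 <= \sum_(0 <= j < m) d.+1 * w * f (m - w * j).
Proof.
move=> hf w0.
(* Keeping the remainder in the statement makes the sum telescope; at [n = m] the remainder vanishes
   because [w] is positive and subtraction is truncated. *)
suff main n : m ^ d.+1 <=
    \sum_(0 <= j < n) d.+1 * w * f (m - w * j) + (m - w * n) ^ d.+1.
  have := main m; have -> : m - w * m = 0 by nia.
  by rewrite exp0n // addn0.
elim: n => [|n IH]; first by rewrite big_nil muln0 subn0.
rewrite big_nat_recr //=; set S := \sum_(_ <= _ < _) _ in IH *.
have [t0|t0] := posnP (m - w * n).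
  by move: IH; rewrite t0 exp0n //; lia.
have := expn_subl_bound d w (m - w * n); have := hf _ t0.
rewrite (_ : m - w * n.+1 = m - w * n - w); last by nia.
move: (_ ^ d.+1) IH => X IH; move: ((_ - w) ^ _) => Y.
move: (_ ^ d) (f _) => u v uv.
have : d.+1 * w * u <= d.+1 * w * v by rewrite leq_mul2l uv orbT.
by move: (d.+1 * w * u) (d.+1 * w * v); lia.
Qed.

Lemma sum_expn_upper d w m sg f : (forall t, 0 < t -> f t <= (t + sg) ^ d) ->
  f 0 = 0 ->
  \sum_(0 <= j < m) d.+1 * w * f (m - w * j) <= (m + (w + sg)) ^ d.+1.
Proof.
move=> hf f0.
suff main n : \sum_(0 <= j < n) d.+1 * w * f (m - w * j) +
    (m + (w + sg) - w * n) ^ d.+1 <= (m + (w + sg)) ^ d.+1.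
  by apply: leq_trans (main m); exact: leq_addr.
elim: n => [|n IH]; first by rewrite big_nil muln0 subn0.
rewrite big_nat_recr //=; set S := \sum_(_ <= _ < _) _ in IH *.
have [t0|t0] := posnP (m - w * n).
  rewrite t0 f0 muln0 addn0; apply: leq_trans IH;
    rewrite leq_add2l leq_exp2r //.
  by nia.
apply: leq_trans IH; rewrite -addnA leq_add2l.
have -> : m + (w + sg) - w * n.+1 = m - w * n + sg by nia.
have -> : m + (w + sg) - w * n = m - w * n + sg + w by lia.
apply: leq_trans (expn_addl_bound _ _ _).
by rewrite leq_add2r leq_mul2l hf ?orbT.
Qed.

(** The range of [j] is generous: once [w 0 * j] reaches [m], the truncated difference is 0 and the
    recursive list is empty. This is why the base case tests [0 < m]. *)
Fixpoint expo_lt d (w : nat -> nat) m : seq (seq nat) :=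
  if d is d'.+1 then
    [seq j :: s | j <- iota 0 m, s <- expo_lt d' (fun i => w i.+1) (m - w 0 *
      j)]
  else nseq (0 < m) [::].

Definition wt d (w : nat -> nat) s := \sum_(i < d) w i * nth 0 s i.

Lemma wt_cons d (w : nat -> nat) j s :
  wt d.+1 w (j :: s) = w 0 * j + wt d (fun i => w i.+1) s.
Proof. by rewrite /wt big_ord_recl. Qed.

Lemma wt_incr d (w : nat -> nat) s i : i < d ->
  wt d w (incr_nth s i) = wt d w s + w i.
Proof.
move=> id; rewrite /wt (bigD1 (Ordinal id)) //= [in RHS](bigD1 (Ordinal id))
  //=.
rewrite nth_incr_nth eqxx mulnDr muln1 -addnA addnC; congr (_ + _ + _).
apply: eq_bigr => j; rewrite -val_eqE /= => /negbTE ji.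
by rewrite nth_incr_nth eq_sym ji.
Qed.

Lemma mem_expo_lt d (w : nat -> nat) m s : (forall i, 0 < w i) ->
  (s \in expo_lt d w m) = (size s == d) && (wt d w s < m).
Proof.
elim: d w m s => [|d IH] w m s w0.
  rewrite /wt big_ord0 mem_nseq /=; case: s => [|j s]; last by rewrite andbF.
  by rewrite eqxx andbT; case: m.
apply/allpairsPdep/idP => [[j [s' [_ hs' ->]]]|].
  by move: hs'; rewrite IH // => /andP[/eqP /= -> ?]; rewrite eqxx wt_cons /=;
    lia.
case: s => [//|j s]; rewrite wt_cons /= eqSS => /andP[/eqP szs lt_m].
exists j, s; split=> //; last by rewrite IH // szs eqxx /=; lia.
by rewrite mem_iota /=; have := w0 0; nia.
Qed.

Lemma uniq_expo_lt d (w : nat -> nat) m : uniq (expo_lt d w m).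
Proof.
elim: d w m => [|d IH] w m /=; first by case: m.
apply: allpairs_uniq_dep; first exact: iota_uniq.
  by move=> j _; exact: IH.
by move=> [i s] [j s'] _ _ /= [-> ->].
Qed.

Lemma size_expo_lt0 d (w : nat -> nat) : size (expo_lt d w 0) = 0.
Proof. by case: d. Qed.

Lemma size_expo_ltS d (w : nat -> nat) m : size (expo_lt d.+1 w m) =
  \sum_(0 <= j < m) size (expo_lt d (fun i => w i.+1) (m - w 0 * j)).
Proof. by rewrite /= size_allpairs_dep sumnE big_map /index_iota subn0. Qed.

(** For positive weights, the reciprocal of the volume of the simplex of nonnegative [y] with
    weighted sum at most 1. *)
Definition wfact d (w : nat -> nat) := d`! * \prod_(i < d) w i.

Lemma wfactS d (w : nat -> nat) :
  wfact d.+1 w = d.+1 * w 0 * wfact d (fun i => w i.+1).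
Proof. by rewrite /wfact factS big_ord_recl mulnACA. Qed.

(** Geometrically, the unit cubes at the counted lattice points cover the simplex of weight below
    [m]. The proof slices by the first coordinate. The side condition excludes [m = d = 0], where
    the power is 1 and the list is empty. *)
Lemma size_expo_lt_lower d (w : nat -> nat) m : (forall i, 0 < w i) ->
  (0 < m) || (0 < d) -> m ^ d <= wfact d w * size (expo_lt d w m).
Proof.
elim: d w m => [|d IH] w m w0 md.
  by rewrite orbF in md; rewrite expn0 /wfact big_ord0 /= md.
rewrite wfactS size_expo_ltS -mulnA !big_distrr /=.
apply: (@sum_expn_lower d (w 0) m (fun t => wfact d (fun i => w i.+1) *
  size (expo_lt d (fun i => w i.+1) t))) => //.
by move=> t t0; apply: IH => //; rewrite t0.
Qed.

(** The same unit cubes stay inside the simplex enlarged by the weight of the diagonal of a cube,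
    which is the sum of the [w i]. *)
Lemma size_expo_lt_upper d (w : nat -> nat) m :
  wfact d w * size (expo_lt d w m) <= (m + \sum_(i < d) w i) ^ d.
Proof.
elim: d w m => [|d IH] w m.
  by rewrite expn0 /wfact big_ord0 /=; case: m.
rewrite wfactS size_expo_ltS -mulnA !big_distrr /= big_ord_recl /=.
apply: (@sum_expn_upper d (w 0) m _ (fun t => wfact d (fun i => w i.+1) *
  size (expo_lt d (fun i => w i.+1) t))) => [t _|].
  exact: IH.
by rewrite size_expo_lt0 muln0.
Qed.

Fixpoint box_expo d m : seq (seq nat) :=
  if d is d'.+1 then [seq j :: s | j <- iota 0 m, s <- box_expo d' m]
  else [:: [::]].

Lemma size_box_expo d m : size (box_expo d m) = m ^ d.
Proof.
by elim: d => [|d IH] //=; rewrite size_allpairs size_iota IH expnS.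
Qed.

Lemma mem_box_expo d m s :
  (s \in box_expo d m) = (size s == d) && all (fun j => j < m) s.
Proof.
elim: d s => [|d IH] s; first by case: s.
apply/allpairsP/idP => [[[j s'] /= [+ + ->]]|].
  by rewrite mem_iota IH /= => /= -> /andP[/eqP -> ->]; rewrite eqxx.
case: s => [//|j s] /=; rewrite eqSS => /andP[szs /andP[jm alls]].
by exists (j, s); rewrite mem_iota IH szs jm alls.
Qed.

End Counting.

(** * Monomial ideals *)

Section Monomials.
Variables (A : comPzRingType) (d : nat).
Implicit Types (x : 'I_d -> A) (s : seq nat) (w : nat -> nat) (J : set A).

Definition mon x s : A := \prod_(i < d) x i ^+ nth 0%N s i.

Lemma mon_incr x s (i : 'I_d) : mon x (incr_nth s i) = x i * mon x s.
Proof.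
rewrite /mon (bigD1 i) //= [in RHS](bigD1 i) //= nth_incr_nth eqxx exprS -mulrA.
congr (_ * (_ * _)); apply: eq_bigr => j ji.
by rewrite nth_incr_nth (_ : (i == j :> nat) = false) // eq_sym; exact/negbTE.
Qed.

Lemma mon_exp x b s : mon (fun i => x i ^+ b) s = mon x (map (muln b) s).
Proof.
apply: eq_bigr => i _; rewrite -exprM; congr (_ ^+ _).
have [?|?] := ltnP i (size s); first by rewrite (nth_map 0%N).
by rewrite !nth_default ?size_map ?muln0.
Qed.

Lemma mon_divn x b s : (0 < b)%N -> size s = d ->
  mon x s = mon x (map (modn^~ b) s) * mon (fun i => x i ^+ b) (map (divn^~ b)
    s).
Proof.
move=> b0 szs; rewrite -big_split; apply: eq_bigr => i _ /=.
rewrite !(nth_map 0%N) ?szs // -exprM -exprD; congr (_ ^+ _).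
by rewrite addnC mulnC -divn_eq.
Qed.

Definition box x b : set A := ideal_gen (range (fun i => x i ^+ b)).

Definition wideal x w n : set A := ideal_gen
  [set a | exists s, [/\ size s = d, (n <= wt d w s)%N & a = mon x s]].

Lemma box_ideal x b : is_ideal (box x b).
Proof. exact: ideal_gen_ideal. Qed.

Lemma wideal_ideal x w n : is_ideal (wideal x w n).
Proof. exact: ideal_gen_ideal. Qed.

Lemma mem_wideal x w n s :
  size s = d -> (n <= wt d w s)%N -> wideal x w n (mon x s).
Proof. by move=> szs ns; apply: sub_ideal_gen; exists s. Qed.

Lemma mem_box x b (i : 'I_d) n s : (b <= n)%N -> nth 0%N s i = n -> box x b
  (mon x s).
Proof.
move=> bn si; rewrite /mon (bigD1 i) //= si -(subnK bn) exprD -mulrA.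
apply: (ideal_mull _ (box_ideal x b)).
by apply: (ideal_mulr _ (box_ideal x b)); apply: sub_ideal_gen; exists i.
Qed.

(** An element of [T] stands for a cube of side [b] of exponents. Modulo [J] and the cubes further
    out, the monomial at the lower corner is killed by every [x i ^+ b], so it generates a quotient
    of [A] modulo [box x b] and costs at most [c]. *)
Lemma len_le_blocks x b c J (T : seq (seq nat)) :
  is_ideal J -> len_le (box x b) setT c ->
  (forall s (i : 'I_d), s \in T ->
     J (mon (fun i => x i ^+ b) (incr_nth s i)) \/ incr_nth s i \in T) ->
  exists K, [/\ is_ideal K, J `<=` K,
    (forall s, s \in T -> K (mon (fun i => x i ^+ b) s))
    & len_le J K (size T * c)].
Proof.
set y := fun i => x i ^+ b => idJ lenb incrT.
(* Increasing total degree puts the successors [incr_nth s i] behind [s] in the list, and the tail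
   of the list is adjoined first. *)
pose deg := wt d (fun=> 1%N); pose T' := sort (relpre deg leq) T.
have memT' s : (s \in T') = (s \in T) by rewrite mem_sort.
exists (adjoins J (map (mon y) T')); split.
- exact: adjoins_ideal.
- exact: sub_adjoins.
- by move=> s sT; apply: mem_adjoins => //; apply: map_f; rewrite memT'.
rewrite -(size_sort (relpre deg leq) T); apply: len_le_adjoins lenb _ => //.
move=> s1 s s2 def_T'; have idK := adjoins_ideal (map (mon y) s2) idJ.
apply: ideal_gen_min; first exact: ideal_colon_ideal.
move=> _ [i _ <-]; rewrite /ideal_colon /= -/(y i) -mon_incr.
have sT : s \in T by rewrite -memT' def_T' mem_cat mem_head orbT.
have [?|] := incrT s i sT; first exact: sub_adjoins.
rewrite -memT' def_T' mem_cat inE => /or3P[s1i|/eqP eq_s|s2i].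
- have : pairwise (relpre deg leq) T'.
    rewrite -sorted_pairwise; first exact: (sort_sorted (fun s t => leq_total _
      _)).
    by move=> u v t /=; exact: leq_trans.
  rewrite def_T' pairwise_cat => /and3P[/allrelP rel12 _ _].
  have /= := rel12 _ s s1i (mem_head _ _).
  by rewrite /deg wt_incr // addn1 ltnn.
- by have := congr1 deg eq_s; rewrite /deg wt_incr //; lia.
- by apply: mem_adjoins => //; exact: map_f.
Qed.

(** The cubes needed are those whose lower corner [b * s] may have weight below [n]; if [wt d w s]
    exceeds [n %/ b], the corner monomial already lies in [wideal x w n]. *)
Lemma wideal_upper x w n b c : (forall i, (0 < w i)%N) -> (0 < b)%N ->
  len_le (box x b) setT c ->
  len_le (wideal x w n) setT (size (expo_lt d w (n %/ b).+1) * c).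
Proof.
move=> w0 b0 lenb.
have [|K [idK _ KT lenK]] := len_le_blocks (T := expo_lt d w (n %/ b).+1)
    (wideal_ideal x w n) lenb.
  move=> s i; rewrite !mem_expo_lt // => /andP[/eqP szs lts].
  have sz : size (incr_nth s i) = d by rewrite size_incr_nth szs ltn_ord.
  rewrite sz eqxx /=; have [_|lt] := ltnP; [by right|left].
  rewrite mon_exp; apply: mem_wideal; first by rewrite size_map.
  have -> : wt d w (map (muln b) (incr_nth s i)) = (b * wt d w (incr_nth s
    i))%N.
    rewrite /wt big_distrr; apply: eq_bigr => j _ /=.
    by rewrite (nth_map 0%N) ?sz //= mulnCA.
  by have := ltn_ceil n b0; nia.
(* The cube at the origin contributes the monomial 1, so [K] is the whole ring. *)
rewrite (_ : setT = K) //; apply/esym/ideal_one => //.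
have := KT (nseq d 0%N); rewrite mem_expo_lt // size_nseq eqxx /=.
rewrite (_ : mon _ _ = 1); last by apply: big1 => i _;
  rewrite nth_nseq if_same expr0.
apply; rewrite (_ : wt _ _ _ = 0%N) //; apply: big1 => i _.
by rewrite nth_nseq if_same muln0.
Qed.

Lemma box_sub_wideal x w n : (forall i, (0 < w i)%N) ->
  box x n `<=` wideal x w n.
Proof.
move=> w0; apply: ideal_gen_min; first exact: wideal_ideal.
move=> _ [i _ <-].
rewrite (_ : x i ^+ n = mon x (mkseq (fun j => if j == i :> nat then n else
  0%N) d)).
  apply: mem_wideal; first by rewrite size_mkseq.
  rewrite /wt (bigD1 i) //= nth_mkseq // eqxx; have := w0 i; nia.
rewrite /mon (bigD1 i) //= nth_mkseq // eqxx big1 ?mulr1 // => j ji.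
rewrite nth_mkseq // (_ : (j == i :> nat) = false) //; exact/negbTE.
Qed.

(** The lower bound for [colength (wideal x w n)], written without subtraction. Of the
    [(n %/ b).+1 ^ d] cubes filling the big box, those reaching weight [n] generate, together with
    the box ideal, an ideal containing [wideal x w n]; the [expo_lt] term counts cubes that stay
    below weight [n]. *)
Lemma colength_box_upper x w n b : (forall i, (0 < w i)%N) -> (0 < b)%N ->
  (forall b, (0 < b)%N -> finite_colength (box x b)) ->
  (colength (box x (b * (n %/ b).+1)) +
   size (expo_lt d w (n %/ b - \sum_(i < d) w i)) * colength (box x b) <=
   colength (wideal x w n) + (n %/ b).+1 ^ d * colength (box x b))%N.
Proof.
move=> w0 b0 fin; set m := (n %/ b)%N; set sg := (\sum_(i < d) w i)%N.
have lenb := len_le_colength (box_ideal x b) (fin b b0).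
(* The right side is the weight of the upper corner of the cube, whose exponents are
   [b * nth 0 s i + b.-1]. *)
pose big s := (n <= b * wt d w s + b.-1 * sg)%N.
pose T := [seq s <- box_expo d m.+1 | big s].
have finw : finite_colength (wideal x w n).
  exists (size (expo_lt d w (n %/ b).+1) * colength (box x b))%N.
  exact: wideal_upper.
have bsum s : (b * wt d w s + b.-1 * sg =
    \sum_(i < d) w i * (b * nth 0 s i + b.-1))%N.
  rewrite /wt !big_distrr -big_split; apply: eq_bigr => i _ /=; lia.
have [s i|K [idK JK KT lenK]] := len_le_blocks (T := T)
    (box_ideal x (b * m.+1)%N) lenb.
  rewrite !mem_filter !mem_box_expo => /and3P[bigs /eqP szs alls].
  have sz : size (incr_nth s i) = d by rewrite size_incr_nth szs ltn_ord.
  have [lt_si|le_si] := ltnP (nth 0%N s i).+1 m.+1.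
    right; rewrite sz eqxx /big wt_incr // /=; apply/andP; split.
      by rewrite /big in bigs; lia.
    apply/(all_nthP 0%N) => j; rewrite sz => jd; rewrite nth_incr_nth.
    have [<- //|_] := eqVneq (i : nat) j.
    by rewrite add0n; apply: (allP alls); rewrite mem_nth ?szs.
  left; rewrite mon_exp; apply: (mem_box (i := i) (n := (b * (nth 0 s
    i).+1)%N)).
    by rewrite leq_mul2l le_si orbT.
  by rewrite (nth_map 0%N) ?sz // nth_incr_nth eqxx.
have wK : wideal x w n `<=` K.
  apply: ideal_gen_min => // _ [s [szs lew ->]].
  (* A monomial of weight at least [n] either lies in a cube of the big box, whose upper corner is
     then at least as heavy, or has an exponent at least [b * m.+1] and lies in the box ideal. *)
  have [all_s|] := boolP (all (fun j => j < m.+1)%N (map (divn^~ b) s)).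
    rewrite (mon_divn x b0 szs); apply: ideal_mull => //; apply: KT.
    rewrite mem_filter mem_box_expo size_map szs eqxx all_s !andbT /big bsum.
    apply: leq_trans lew _; apply: leq_sum => i _.
    rewrite (nth_map 0%N) ?szs // leq_mul2l; apply/orP; right.
    by have := ltn_ceil (nth 0%N s i) b0; nia.
  rewrite -has_predC => /(has_nthP 0%N)[i]; rewrite size_map => lti.
  rewrite (nth_map 0%N) //= -leqNgt => le_m; apply: JK.
  rewrite szs in lti; apply: (mem_box (i := Ordinal lti) _ erefl) => /=.
  by have := leq_trunc_div (nth 0%N s i) b; nia.
have lenJ : (colength (box x (b * m.+1)) <=
    size T * colength (box x b) + colength (wideal x w n))%N.
  apply: colength_le; first exact: box_ideal.
  apply: len_le_trans lenK _ => //; first exact: box_ideal.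
  apply: len_le_mono (len_le_colength (wideal_ideal x w n) finw) => //.
(* If [wt d w s < m - sg], the upper corner has weight less than [b * m], hence less than [n], so
   the cube is not in [T]. *)
have szT : (size T + size (expo_lt d w (m - sg)) <= m.+1 ^ d)%N.
  rewrite -size_box_expo -(count_predC big (box_expo d m.+1)) size_filter
    leq_add2l -size_filter.
  apply: uniq_leq_size; first exact: uniq_expo_lt.
  move=> s; rewrite mem_expo_lt // mem_filter mem_box_expo.
  move=> /andP[/eqP szs lts]; rewrite szs eqxx /= /big -ltnNge; apply/andP;
    split.
    by have := leq_trunc_div n b; rewrite -/m; nia.
  apply/(all_nthP 0%N) => i; rewrite szs => lti.
  have : (w i * nth 0 s i <= wt d w s)%N.
    by rewrite /wt (bigD1 (Ordinal lti)) //= leq_addr.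
  by have := w0 i; nia.
apply: leq_trans (leq_add lenJ (leqnn _)) _.
rewrite addnAC addnC leq_add2l -mulnDl leq_mul2r; apply/orP; right; lia.
Qed.

End Monomials.

(** * Limits *)

Section Asymptotics.
Variables (R : realType) (d : nat) (d_gt0 : (0 < d)%N).
Variable B : nat -> nat.

Definition ratios : set R :=
  [set (B b)%:R / b%:R ^+ d | b in [set b | (0 < b)%N]].

Definition rate : R := inf ratios.

Lemma rate_lbound : lbound ratios 0.
Proof. by move=> _ [b _ <-]; rewrite divr_ge0 ?exprn_ge0. Qed.

Lemma rate_ge0 : 0 <= rate.
Proof.
by apply: lb_le_inf; [exists ((B 1)%:R / 1%:R ^+ d);
  exists 1%N|exact: rate_lbound].
Qed.

Lemma rate_le b : (0 < b)%N -> rate * b%:R ^+ d <= (B b)%:R.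
Proof.
move=> b0; rewrite -ler_pdivlMr ?exprn_gt0 ?ltr0n //.
by apply: ge_inf; [exists 0; exact: rate_lbound|exists b].
Qed.

Lemma rate_approx (e : R) : 0 < e ->
  exists2 b, (0 < b)%N & (B b)%:R <= (rate + e) * b%:R ^+ d.
Proof.
move=> e0; have hinf : has_inf ratios.
  split; last by exists 0; exact: rate_lbound.
  by exists ((B 1)%:R / 1%:R ^+ d); exists 1%N.
have [_ [b /= b0 <-] lt] := inf_adherent e0 hinf.
by exists b => //; rewrite -ler_pdivrMr ?exprn_gt0 ?ltr0n // ltW.
Qed.

Lemma cvg_exprn_1Dinv (C : R) : (1 + C * n%:R^-1) ^+ d @[n --> \oo] --> (1 : R).
Proof.
have h1 : 1 + C * n%:R^-1 @[n --> \oo] --> (1 : R).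
  have h0 : (n%:R^-1 : R) @[n --> \oo] --> (0 : R).
    apply/(gtr0_cvgV0 (f := fun n : nat => n%:R : R)); last exact: cvgr_idn.
    by exists 1%N => // n /= n1; rewrite ltr0n.
  have h : 1 + C * n%:R^-1 @[n --> \oo] --> 1 + C * 0.
    by apply: cvgD; [exact: cvg_cst|apply: cvgM => //; exact: cvg_cst].
  by rewrite mulr0 addr0 in h.
elim: d => [|e IH]; first exact: cvg_cst.
rewrite (_ : (fun n : nat => _) =
  fun n => (1 + C * n%:R^-1) * (1 + C * n%:R^-1) ^+ e).
  by have h := cvgM h1 IH; rewrite mulr1 in h; exact: h.
by apply/funext => n; rewrite exprS.
Qed.

Variables (W : nat) (l : nat -> nat).
(** The two covering estimates as pure numerics, for [W = wfact d w]. Up to errors [C] that depend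
    on [b] but not on [n], [p * b], [s * b] and [t * b] all approximate [n]. *)
Hypothesis l_upper : forall b, (0 < b)%N -> exists C, forall n, exists p,
  (p * b <= n + C)%N /\ (W * l n <= p ^ d * B b)%N.
Hypothesis l_lower : forall b, (0 < b)%N -> exists C, forall n, exists s t,
  [/\ (n <= s * b + C)%N, (t * b <= n + C)%N, (0 < t)%N &
     (W * B (b * t) + s ^ d * B b <= W * l n + W * t ^ d * B b)%N].

Lemma cvg_rate : (W%:R * (l n)%:R / n%:R ^+ d : R) @[n --> \oo] --> rate.
Proof.
apply/cvgrPdist_le => dl dl0.
have r0 := rate_ge0; set r := rate in r0 *.
have W0 : 0 <= W%:R :> R by [].
(* The upper estimate errs by at most [e * (r + 2)] and the lower one by at most [e * (r + 2 * W)],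
   relative to [n ^ d]; the summand [dl] in the denominator forces [e <= 1], which bounds [e * e]
   and [1 + e]. *)
pose e := dl / (r + 2 + 2 * W%:R + dl).
have den0 : 0 < r + 2 + 2 * W%:R + dl by lra.
have e0 : 0 < e by rewrite divr_gt0.
have def_e : e * (r + 2 + 2 * W%:R + dl) = dl by rewrite /e divfK ?gt_eqF.
have e1 : e <= 1 by rewrite /e ler_pdivrMr // mul1r; lra.
clearbody e.
have [b b0 Bb] := rate_approx e0; rewrite -/r in Bb.
have rB := rate_le b0; rewrite -/r in rB.
have [C1 hU] := l_upper b0; have [C2 hL] := l_lower b0.
have /cvgrPdist_le/(_ e e0) u1 := cvg_exprn_1Dinv C1%:R.
have /cvgrPdist_le/(_ e e0) u2 := cvg_exprn_1Dinv C2%:R.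
have /cvgrPdist_le/(_ e e0) u3 := cvg_exprn_1Dinv (- C2%:R).
have bd0 : 0 < b%:R ^+ d :> R by rewrite exprn_gt0 // ltr0n.
near=> n.
have n0 : (0 < n)%N by near: n; exact: nbhs_infty_gt.
have nC2 : (C2 < n)%N by near: n; exact: nbhs_infty_gt.
have nd0 : 0 < n%:R ^+ d :> R by rewrite exprn_gt0 // ltr0n.
have scale (C : R) : (n%:R + C) ^+ d = (1 + C * n%:R^-1) ^+ d * n%:R ^+ d.
  by rewrite -exprMn; congr (_ ^+ _); field; rewrite pnatr_eq0 -lt0n.
have : `|1 - (1 + C1%:R * n%:R^-1) ^+ d| <= e by near: n.
rewrite ler_distlC => /andP[_ v1].
have : `|1 - (1 + C2%:R * n%:R^-1) ^+ d| <= e by near: n.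
rewrite ler_distlC => /andP[_ v2].
have : `|1 - (1 + - C2%:R * n%:R^-1) ^+ d| <= e by near: n.
rewrite ler_distlC => /andP[v3 _].
have [p [pn Up]] := hU n; have [s [t [sn tn t0 Lst]]] := hL n.
have rBt := rate_le (b := (b * t)%N); rewrite muln_gt0 b0 t0 in rBt.
have {}rBt := rBt isT; rewrite -/r natrM exprMn in rBt.
have Up' : W%:R * (l n)%:R <= p%:R ^+ d * (B b)%:R :> R.
  by rewrite -natrX -!natrM ler_nat.
have Lst' : W%:R * (B (b * t))%:R + s%:R ^+ d * (B b)%:R
    <= W%:R * (l n)%:R + W%:R * t%:R ^+ d * (B b)%:R :> R.
  by rewrite -!natrX -!natrM -!natrD ler_nat.
have pb : p%:R ^+ d * b%:R ^+ d <= (1 + e) * n%:R ^+ d :> R.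
  apply: (@le_trans _ _ ((n%:R + C1%:R) ^+ d)).
    by rewrite -exprMn -natrM -natrD lerXn2r ?nnegrE // ler_nat.
  by rewrite scale ler_pM2r.
have tb : t%:R ^+ d * b%:R ^+ d <= (1 + e) * n%:R ^+ d :> R.
  apply: (@le_trans _ _ ((n%:R + C2%:R) ^+ d)).
    by rewrite -exprMn -natrM -natrD lerXn2r ?nnegrE // ler_nat.
  by rewrite scale ler_pM2r.
have sb : (1 - e) * n%:R ^+ d <= s%:R ^+ d * b%:R ^+ d :> R.
  apply: (@le_trans _ _ ((n%:R - C2%:R) ^+ d)).
    by rewrite scale ler_pM2r.
  rewrite -exprMn -natrM lerXn2r ?nnegrE ?subr_ge0 ?ler_nat 1?ltnW //.
  by rewrite lerBlDr -natrD ler_nat.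
have pd0 : 0 <= p%:R ^+ d :> R by rewrite exprn_ge0.
have td0 : 0 <= t%:R ^+ d :> R by rewrite exprn_ge0.
have sd0 : 0 <= s%:R ^+ d :> R by rewrite exprn_ge0.
move: (b%:R ^+ d) (n%:R ^+ d) (p%:R ^+ d) (s%:R ^+ d) (t%:R ^+ d) (B (b * t))%:R
  (B b)%:R (W%:R : R) (l n)%:R W0 bd0 nd0 pd0 td0 sd0 pb tb sb Lst' Up' rBt rB
    Bb
  den0 def_e => bd nd pd sd td Bt Bb' W' ln W0 bd0 nd0 pd0 td0 sd0 pb tb sb
  Lst' Up' rBt rB Bb den0 def_e.
have edl : 0 <= e * dl by rewrite mulr_ge0 // ltW.
have eW : 0 <= W' * e by rewrite mulr_ge0 // ltW.
have ee : e * e <= e by rewrite ler_piMr // ltW.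
rewrite ler_distlC; apply/andP; split.
(* [B (b * t)] is bounded below by the infimum and [B b] above by its near-optimality, so the two
   terms with factor [W * t ^ d] cancel up to [e]; the term with [s ^ d] supplies [r]. *)
- rewrite ler_pdivlMr //.
  have : (W' * td) * Bb' <= (W' * td) * ((r + e) * bd).
    by rewrite ler_wpM2l // mulr_ge0.
  have : sd * (r * bd) <= sd * Bb' by rewrite ler_wpM2l.
  have : W' * (r * (bd * td)) <= W' * Bt by rewrite ler_wpM2l.
  have : r * ((1 - e) * nd) <= r * (sd * bd) by rewrite ler_wpM2l.
  have : W' * e * (td * bd) <= W' * e * ((1 + e) * nd).
    by rewrite ler_wpM2l // mulr_ge0 // ltW.
  have : W' * e * ((1 + e) * nd) <= W' * e * (2 * nd).
    by apply: ler_wpM2l => //; apply: ler_wpM2r; [exact: ltW|lra].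
  have : (r * e + 2 * (W' * e)) * nd <= dl * nd.
    by rewrite ler_pM2r //; lra.
  lra.
- rewrite ler_pdivrMr //.
  have : pd * Bb' <= pd * ((r + e) * bd) by rewrite ler_wpM2l.
  have : (r + e) * (pd * bd) <= (r + e) * ((1 + e) * nd).
    by rewrite ler_wpM2l // addr_ge0 // ltW.
  have : (r + e) * (1 + e) * nd <= (r + dl) * nd.
    by rewrite ler_pM2r //; lra.
  lra.
Unshelve. all: by end_near. Qed.

End Asymptotics.

(** * Powers of ideals and weighted monomials *)

Section Powers.
Variable A : comPzRingType.
Implicit Types (I J : set A).

Lemma ideal_powM I m n u v :
  ideal_pow I m u -> ideal_pow I n v -> ideal_pow I (m + n) (u * v).
Proof.
move=> + hv; elim: m u => [|m IH] u hu.
  by apply: ideal_mull => //; exact: ideal_pow_ideal.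
have idc : is_ideal (ideal_colon (ideal_pow I (m.+1 + n)) v).
  by apply: ideal_colon_ideal; exact: ideal_pow_ideal.
apply: (ideal_mul_sub idc _ hu) => a b Ia hb; rewrite /ideal_colon /= -mulrA.
by apply: ideal_mul_mem => //; exact: IH.
Qed.

Lemma ideal_powX I m u e : ideal_pow I m u -> ideal_pow I (m * e) (u ^+ e).
Proof.
move=> hu; elim: e => [|e IH]; first by rewrite muln0.
by rewrite mulnS exprS; exact: ideal_powM.
Qed.

Lemma mon_ideal_pow I d (x : 'I_d -> A) (w : nat -> nat) s :
  (forall i : 'I_d, ideal_pow I (w i) (x i)) -> ideal_pow I (wt d w s) (mon x
    s).
Proof.
move=> hx; rewrite /wt /mon.
elim/big_ind2: _ => // [m u n v hu hv|i _]; first exact: ideal_powM.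
exact: ideal_powX.
Qed.

Lemma wideal_sub_pow I d (x : 'I_d -> A) (w : nat -> nat) n :
  (forall i : 'I_d, ideal_pow I (w i) (x i)) -> wideal x w n `<=` ideal_pow I n.
Proof.
move=> hx; apply: ideal_gen_min; first exact: ideal_pow_ideal.
by move=> _ [s [_ ns ->]]; apply: (ideal_pow_le ns); exact: mon_ideal_pow.
Qed.

Lemma wideal0 d (x : 'I_d -> A) (w : nat -> nat) : wideal x w 0 = setT.
Proof.
apply: ideal_one; first exact: wideal_ideal.
apply: sub_ideal_gen; exists (nseq d 0%N); split=> //;
  first by rewrite size_nseq.
by rewrite /mon big1 // => i _; rewrite nth_nseq if_same expr0.
Qed.

Lemma wideal_mulx d (x : 'I_d -> A) (w : nat -> nat) (i : 'I_d) m n u :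
  (m <= w i + n)%N -> wideal x w n u -> wideal x w m (x i * u).
Proof.
move=> mn; rewrite mulrC.
have idc := ideal_colon_ideal (x i) (wideal_ideal x w m).
apply: (ideal_gen_min idc) => _ [s [szs ns ->]].
rewrite /ideal_colon /= mulrC -mon_incr; apply: sub_ideal_gen.
exists (incr_nth s i); split=> //; first by rewrite size_incr_nth szs ltn_ord.
by rewrite wt_incr //; lia.
Qed.

Lemma ideal_pow_gen d (x : 'I_d -> A) n :
  ideal_pow (ideal_gen (range x)) n = wideal x (fun=> 1%N) n.
Proof.
apply/seteqP; split.
  elim: n => [|n IH]; first by rewrite wideal0.
  apply: ideal_mul_sub; first exact: wideal_ideal.
  move=> u v hu hv.
  have idc := ideal_colon_ideal v (wideal_ideal x (fun=> 1%N) n.+1).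
  apply: (ideal_gen_min idc _ hu) => _ [i _ <-]; rewrite /ideal_colon /=.
  by apply: (wideal_mulx (n := n)) => //; exact: IH.
apply: wideal_sub_pow => i; rewrite -[x i]mulr1; apply: ideal_mul_mem => //.
by apply: sub_ideal_gen; exists i.
Qed.

End Powers.

(** * Multiplicities as limits of weighted colengths *)

Section Limits.
Variables (R : realType) (A : comPzRingType) (d : nat) (x : 'I_d -> A).
Hypothesis d_gt0 : (0 < d)%N.
Hypothesis box_fin : forall b, (0 < b)%N -> finite_colength (box x b).

Definition box_rate : R := rate R d (fun b => colength (box x b)).

Lemma finite_wideal w n : (forall i, (0 < w i)%N) -> finite_colength (wideal x
  w n).
Proof.
move=> w0; exists (size (expo_lt d w (n %/ 1).+1) * colength (box x 1))%N.
by apply: wideal_upper => //; apply: len_le_colength;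
  [exact: box_ideal|exact: box_fin].
Qed.

(** Allowing a bounded shift [c] costs nothing in the limit and lets [l] be the colength of the
    powers of any ideal squeezed between weighted ideals. *)
Lemma cvg_wideal w (l : nat -> nat) c : (forall i, (0 < w i)%N) ->
  (forall n, l n <= colength (wideal x w n))%N ->
  (forall n, colength (wideal x w (n - c)) <= l n)%N ->
  ((wfact d w)%:R * (l n)%:R / n%:R ^+ d : R) @[n --> \oo] --> box_rate.
Proof.
move=> w0 l_le le_l; set sg := (\sum_(i < d) w i)%N.
apply: cvg_rate => // b b0.
- exists (b + sg * b)%N => n; exists ((n %/ b).+1 + sg)%N; split.
    by have := leq_trunc_div n b; nia.
  apply: leq_trans (leq_mul (size_expo_lt_upper d w (n %/ b).+1) (leqnn _)).
  rewrite -mulnA leq_mul2l; apply/orP; right; apply: leq_trans (l_le n) _.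
  apply: colength_le; first exact: wideal_ideal.
  by apply: wideal_upper => //; apply: len_le_colength;
    [exact: box_ideal|exact: box_fin].
(* [b] pays for rounding in the division, [sg * b] for the cubes cut by the boundary of the simplex,
   [c] for the shift. *)
- exists (b + sg * b + c)%N => n; set m := ((n - c) %/ b)%N.
  exists (m - sg)%N, m.+1; split => //.
  + by have := ltn_ceil (n - c) b0; rewrite -/m; nia.
  + by have := leq_trunc_div (n - c) b; rewrite -/m; nia.
  have := @colength_box_upper _ _ x w (n - c)%N b w0 b0 box_fin.
  rewrite -/m -/sg => hbox.
  have hlow : ((m - sg) ^ d <= wfact d w * size (expo_lt d w (m - sg)))%N.
    by apply: size_expo_lt_lower => //; rewrite d_gt0 orbT.
  have := leq_trans hbox (leq_add (le_l n) (leqnn _)).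
  rewrite -(leq_pmul2l (_ : 0 < wfact d w)%N); last first.
    by rewrite muln_gt0 fact_gt0 prodn_gt0.
  rewrite !mulnDr !mulnA => h; apply: leq_trans h; rewrite leq_add2l.
  by rewrite leq_mul2r hlow orbT.
Qed.

Lemma hs_mult_cvg (B : comPzRingType) (I : set B) P (r : R) : (0 < P)%N ->
  ((d`! * P)%:R * (colength (ideal_pow I n))%:R / n%:R ^+ d : R) @[n --> \oo]
    --> r ->
  hs_mult R d I = r / P%:R.
Proof.
move=> P0 h; rewrite /hs_mult; apply/cvg_lim => //.
rewrite (_ : (fun n : nat => _) = fun n : nat =>
  ((d`! * P)%:R * (colength (ideal_pow I n))%:R / n%:R ^+ d : R) * P%:R^-1).
  by apply: cvgM => //; exact: cvg_cst.
apply/funext => n; rewrite natrM; set y := (n%:R ^+ d)^-1.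
by field; rewrite pnatr_eq0 -lt0n.
Qed.

Lemma hs_mult_gen : hs_mult R d (ideal_gen (range x)) = box_rate.
Proof.
rewrite (@hs_mult_cvg _ _ 1 box_rate) // ?divr1 //.
have := @cvg_wideal (fun=> 1%N) _ 0 (fun=> isT) (fun=> leqnn _).
rewrite /wfact big1 // => h.
under eq_fun do rewrite ideal_pow_gen.
by apply: h => n; rewrite subn0.
Qed.

Lemma hs_mult_wideal (I : set A) w c : (forall i, (0 < w i)%N) ->
  (forall n, wideal x w n `<=` ideal_pow I n) ->
  (forall n, ideal_pow I n `<=` wideal x w (n - c)) ->
  hs_mult R d I = box_rate / (\prod_(i < d) w i)%:R.
Proof.
move=> w0 h1 h2; apply: hs_mult_cvg; first by rewrite prodn_gt0.
apply: (@cvg_wideal w _ c) => // n; apply: colength_anti; rewrite ?h1 ?h2 //.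
- exact: wideal_ideal.
- exact: ideal_pow_ideal.
- exact: finite_wideal.
- exact: ideal_pow_ideal.
- exact: wideal_ideal.
- exact: finite_colength_sub (h1 n) (finite_wideal n w0).
Qed.

(* The weight of a vanishing x_i does not matter for wideal, but scales the
  limit. *)
Lemma box_rate0 (i : 'I_d) : x i = 0 -> box_rate = 0.
Proof.
move=> xi0; pose w j := if j == i :> nat then 2%N else 1%N.
have w0 j : (0 < w j)%N by rewrite /w; case: ifP.
have eqw n : wideal x w n = wideal x (fun=> 1%N) n.
  have eqwt s : mon x s = 0 \/ wt d w s = wt d (fun=> 1%N) s.
    have [s0|s0] := posnP (nth 0%N s i); last first.
      by left; rewrite /mon (bigD1 i) //= xi0 expr0n eqn0Ngt s0 mul0r.
    right; apply: eq_bigr => j _; rewrite /w.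
    by case: eqP => [/val_inj ->|_] //; rewrite s0 !muln0.
  apply/seteqP; split; apply: ideal_gen_min;
    rewrite ?[is_ideal _]wideal_ideal //.
  - by apply: wideal_ideal.
  - move=> _ [s [szs ns ->]]; have [->|es] := eqwt s.
      by case: (wideal_ideal x (fun=> 1%N) n).
    by apply: mem_wideal => //; rewrite -es.
  - by apply: wideal_ideal.
  - move=> _ [s [szs ns ->]]; have [->|es] := eqwt s.
      by case: (wideal_ideal x w n).
    by apply: mem_wideal => //; rewrite es.
have wfact2 : wfact d w = (wfact d (fun=> 1%N) * 2)%N.
  rewrite /wfact -mulnA; congr (_ * _)%N.
  rewrite (bigD1 i) //= [in RHS](bigD1 i) //= /w eqxx mulnC; congr (_ * _)%N.
  by rewrite mul1n; apply: eq_bigr => j /negbTE ji; rewrite val_eqE ji.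
pose l n := colength (wideal x w n).
have c1 : (wfact d w)%:R * (l n)%:R / n%:R ^+ d @[n --> \oo] --> box_rate.
  by apply: (@cvg_wideal w l 0) => // n; rewrite subn0.
have c2 : (wfact d (fun=> 1%N))%:R * (l n)%:R / n%:R ^+ d @[n --> \oo]
    --> box_rate.
  by apply: (@cvg_wideal (fun=> 1%N) l 0) => // n; rewrite ?subn0 /l eqw.
have c3 : (wfact d w)%:R * (l n)%:R / n%:R ^+ d @[n --> \oo] --> box_rate * 2.
  rewrite (_ : (fun n : nat => _) = fun n : nat =>
    (wfact d (fun=> 1%N))%:R * (l n)%:R / n%:R ^+ d * 2).
    by apply: cvgM => //; exact: cvg_cst.
  by apply/funext => n; rewrite wfact2 natrM; ring.
have e2 : box_rate = box_rate * 2 by rewrite -{1}(cvg_lim _ c1) // (cvg_lim _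
  c3).
lra.
Qed.

End Limits.

(** * Localization *)

Section Localization.
Local Open Scope quotient_scope.
Variables (A : comNzRingType) (m : set A).
Hypothesis m_prime : is_prime m.
Local Notation L := (loc (~` m)).
Local Notation "a %:L" := (@to_loc A (~` m) a) (at level 2, format "a %:L").

Lemma denom_notin t : submonoid_gen (~` m) t -> ~ m t.
Proof.
case: m_prime => _ m1 mM; move=> /(_ (~` m)); apply=> // u v mu mv uv.
by case: (mM _ _ uv).
Qed.

Lemma notin_denom t : ~ m t -> submonoid_gen (~` m) t.
Proof. by move=> mt M _ _; apply. Qed.

Lemma to_locM a b : (a * b)%:L = a%:L * b%:L.
Proof.
rewrite /to_loc [RHS](_ : _ = loc_mul (\pi_L (a, denom1 _)) (\pi_L (b, denom1
  _))) //.
by rewrite !piE; apply: loc_eqP => /=; ring.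
Qed.

Lemma to_locD a b : (a + b)%:L = a%:L + b%:L.
Proof.
rewrite /to_loc [RHS](_ : _ = loc_add (\pi_L (a, denom1 _)) (\pi_L (b, denom1
  _))) //.
by rewrite !piE; apply: loc_eqP => /=; ring.
Qed.

Lemma to_loc0 : 0%:L = 0 :> L. Proof. by []. Qed.
Lemma to_loc1 : 1%:L = 1 :> L. Proof. by []. Qed.

Lemma to_loc_eq a b : a%:L = b%:L -> exists2 t, ~ m t & t * a = t * b.
Proof.
move/eqmodP => /asboolP[u /=]; rewrite !mulr1 => e.
by exists (sval u) => //; exact: denom_notin (denomP u).
Qed.

Lemma loc_frac (z : L) : exists a t, [/\ ~ m t & t%:L * z = a%:L].
Proof.
elim/quotW: z => -[a t]; exists a, (sval t); split.
  exact: denom_notin (denomP t).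
rewrite /to_loc [LHS](_ : _ = loc_mul (\pi_L (sval t, denom1 _)) (\pi_L (a,
  t))) //.
by rewrite !piE; apply: loc_eqP => /=; ring.
Qed.

Lemma to_loc_unit t : ~ m t -> exists v : L, t%:L * v = 1.
Proof.
move=> mt; exists (\pi_L (1, mk_denom (notin_denom mt))).
rewrite /to_loc [LHS](_ : _ = loc_mul (\pi_L (t, denom1 _))
  (\pi_L (1, mk_denom (notin_denom mt)))) // -to_loc1 /to_loc.
by rewrite !piE; apply: loc_eqP => /=; ring.
Qed.

Lemma ext_ideal I : is_ideal (ext m I).
Proof. exact: ideal_gen_ideal. Qed.

Lemma mem_ext I a : I a -> ext m I a%:L.
Proof. by move=> Ia; apply: sub_ideal_gen; exists a. Qed.

Lemma ext_min I (K : set L) :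
  is_ideal K -> (forall a, I a -> K a%:L) -> ext m I `<=` K.
Proof. by move=> idK IK; apply: ideal_gen_min => // _ [a Ia <-]; exact: IK. Qed.

Lemma ext_ideal_gen X : ext m (ideal_gen X) = ideal_gen (@to_loc A (~` m) @` X).
Proof.
apply/seteqP; split; last first.
  apply: ideal_gen_mono => _ [a Xa <-]; exists a => //; exact: sub_ideal_gen.
have idg := ideal_gen_ideal (@to_loc A (~` m) @` X).
apply: ext_min => // a Xa.
have idc : is_ideal [set a | ideal_gen (@to_loc A (~` m) @` X) a%:L].
  split=> [|u v|u v] /=; first by case: idg.
    by rewrite to_locD; exact: ideal_add.
  by rewrite to_locM; exact: ideal_mull.
by apply: (ideal_gen_min idc _ Xa) => b Xb; apply: sub_ideal_gen; exists b.
Qed.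

(** The elements that some denominator carries into the image of [I] already form an ideal, so a sum
    of multiples needs only one common denominator. *)
Lemma ext_to_loc I a : is_ideal I -> ext m I a%:L -> exists2 t, ~ m t & I (t *
  a).
Proof.
case: (m_prime) => _ _ mM idI.
pose K : set L := [set z | exists t b, [/\ ~ m t, I b & t%:L * z = b%:L]].
have idK : is_ideal K.
  split.
  - exists 1, 0; split; [by case: m_prime|by case: idI|by rewrite mulr0].
  - move=> z z' [t [b [mt Ib tz]]] [t' [b' [mt' Ib' tz']]].
    exists (t * t'), (t' * b + t * b'); split; first by case/mM.
      by apply: ideal_add => //; exact: ideal_mull.
    by rewrite to_locD !to_locM -tz -tz'; ring.
  - move=> y z [t [b [mt Ib tz]]]; have [a' [t' [mt' ty]]] := loc_frac y.
    exists (t * t'), (a' * b); split; first by case/mM.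
      exact: ideal_mull.
    by rewrite !to_locM -tz -ty; ring.
move=> /(ext_min idK)[b Ib|t [b [mt Ib]]].
  by exists 1, b; split=> //; [case: m_prime|rewrite mul1r].
rewrite -to_locM => /to_loc_eq[t' mt' e]; exists (t' * t); first by case/mM.
by rewrite -mulrA e; exact: ideal_mull.
Qed.

(** An element outside [ext m m] has numerator outside [m] and is therefore a unit, so an ideal
    above [ext m m] is [ext m m] or everything. *)
Lemma len_le_ext_max : len_le (ext m m) setT 1.
Proof.
case=> [//|[//|n]] [c [cm ltc]].
have [idc mc _] := cm 1%N isT; have [_ n0] := ltc 0%N isT.
have [_ m0 _] := cm 0%N isT; have [_ n1] := ltc 1%N isT.
suff c1 : c 1%N = setT by case: n1; rewrite c1.
apply: ideal_one => //; apply: contrapT => nc1; apply: n0 => z cz; apply: m0.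
have [a [t [mt tz]]] := loc_frac z.
have [ma|nma] := pselect (m a).
  have [v tv] := to_loc_unit mt.
  rewrite -[z]mul1r -tv mulrAC tz; apply: (ideal_mulr _ (@ext_ideal m)).
  exact: mem_ext.
case: nc1; have [v av] := to_loc_unit nma.
by rewrite -av -tz; apply: ideal_mulr => //; exact: ideal_mull.
Qed.

End Localization.

(** * Finite colength of powers *)

Section FiniteLength.
Variable A : comPzRingType.
Implicit Types (I J : set A).

Lemma ideal_pow_fg I n : (exists us : seq A, I = ideal_gen [set` us]) ->
  exists us : seq A, ideal_pow I n = ideal_gen [set` us].
Proof.
case=> us ->; elim: n => [|n [vs IH]].
  exists [:: 1]; apply/esym/ideal_one; first exact: ideal_gen_ideal.
  by apply: sub_ideal_gen; rewrite /= mem_head.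
exists [seq u * v | u <- us, v <- vs]; rewrite /= IH.
apply/seteqP; split.
  apply: ideal_mul_gen_sub; first exact: ideal_gen_ideal.
  by move=> u v uus vvs; apply: sub_ideal_gen; apply: allpairs_f.
apply: ideal_gen_min; first exact: ideal_gen_ideal.
move=> _ /allpairsP[[u v] [/= uus vvs ->]].
by apply: ideal_mul_mem; exact: sub_ideal_gen.
Qed.

(** Each quotient of consecutive powers is generated by finitely many elements killed by [I], so its
    length is at most their number times that of [A / I]. *)
Lemma finite_colength_pow I n : is_ideal I -> finite_colength I ->
  (exists us : seq A, I = ideal_gen [set` us]) -> finite_colength (ideal_pow I
    n).
Proof.
move=> idI [c lenI] fgI; elim: n => [|n [e IH]].
  by exists 0%N; exact: len_le_refl.
have idp k := ideal_pow_ideal I k.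
have [vs def_In] := ideal_pow_fg n fgI; exists (size vs * c + e)%N.
apply: len_le_trans IH => //; first exact: ideal_powS_sub.
have : len_le (ideal_pow I n.+1) (adjoins (ideal_pow I n.+1) (map id vs)) (size
  vs * c).
  apply: len_le_adjoins lenI _ => // s1 v s2 def_vs b Ib.
  have Iv : ideal_pow I n v.
    by rewrite def_In; apply: sub_ideal_gen;
      rewrite /= def_vs mem_cat mem_head orbT.
  by apply: sub_adjoins; exact: ideal_mul_mem.
apply: len_le_mono => //; rewrite map_id def_In; apply: ideal_gen_min.
  by apply: adjoins_ideal; exact: idp.
by move=> v vvs; apply: mem_adjoins.
Qed.

End FiniteLength.

(** * Graded algebras *)

Section GradedAlgebra.
Variables (k : fieldType) (S : comAlgType k) (G : nat -> set S).
Hypothesis S_graded : standard_graded G.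
Local Notation hc := (hom_comp G).
Implicit Types (u v x y : S).

Lemma G0 n : G n 0.
Proof. by case: S_graded => /(_ n)[]. Qed.

Lemma GD n u v : G n u -> G n v -> G n (u + v).
Proof. by case: S_graded => /(_ n)[_ + _] _ _ _ _; apply. Qed.

Lemma GZ n c u : G n u -> G n (c *: u).
Proof. by case: S_graded => /(_ n)[_ _ +] _ _ _ _; apply. Qed.

Lemma GM i j u v : G i u -> G j v -> G (i + j)%N (u * v).
Proof. by case: S_graded => _ + _ _ _; apply. Qed.

Lemma G_alg c : G 0%N c%:A.
Proof. by case: S_graded => _ _ _ -> _; exists c. Qed.

Lemma hom_comp_eq x a n : hom_decomp G x a -> hc n x = a n.
Proof.
case: S_graded => _ _ /(_ x)[b [_ uniq_b]] _ _ dxa; rewrite /hom_comp.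
case: xgetP => [_ -> [c dxc ->]|/(_ (a n))]; last by case; exists a.
by rewrite -(uniq_b a dxa) (uniq_b c dxc).
Qed.

Lemma hom_decomp_large x a : hom_decomp G x a ->
  exists N, forall M, (N <= M)%N -> a M = 0 /\ x = \sum_(i < M) a i.
Proof.
case=> _ [N [aN ->]]; exists N => M NM; split; first exact: aN.
rewrite -!(big_mkord xpredT a) (big_cat_nat _ NM) //=.
by rewrite [X in _ + X]big_nat_cond [X in _ + X]big1 ?addr0 // => i
  /andP[/andP[/aN]].
Qed.

Lemma hom_compP x : hom_decomp G x (hc ^~ x).
Proof.
have [a [dxa _]] : exists! a, hom_decomp G x a by case: S_graded.
by have -> : hc ^~ x = a by apply/funext => n; exact: hom_comp_eq.
Qed.

Lemma hom_compG n x : G n (hc n x).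
Proof. by case: (hom_compP x). Qed.

Lemma hom_compD n x y : hc n (x + y) = hc n x + hc n y.
Proof.
apply: (hom_comp_eq (a := fun n => hc n x + hc n y)); split.
  by move=> i; apply: GD; exact: hom_compG.
have [N hN] := hom_decomp_large (hom_compP x).
have [N' hN'] := hom_decomp_large (hom_compP y).
exists (maxn N N'); split=> [i|].
  by rewrite geq_max => /andP[/hN[-> _] /hN'[-> _]]; rewrite addr0.
rewrite big_split /=; have [_ <-] := hN _ (leq_maxl N N').
by have [_ <-] := hN' _ (leq_maxr N N').
Qed.

Lemma hom_comp_G i n u : G i u -> hc n u = if n == i then u else 0.
Proof.
move=> Gu; apply: (hom_comp_eq (a := fun n => if n == i then u else 0)); split.
  by move=> j; case: eqP => [->|_] //; exact: G0.
exists i.+1; split=> [j ij|]; first by rewrite gtn_eqF.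
rewrite big_ord_recr /= eqxx big1 ?add0r // => j _.
by rewrite ltn_eqF.
Qed.

Lemma hom_comp0 n : hc n 0 = 0.
Proof. by rewrite (hom_comp_G _ (G0 n)) if_same. Qed.

Lemma hom_comp_sum n (I : Type) (r : seq I) (P : pred I) (F : I -> S) :
  hc n (\sum_(i <- r | P i) F i) = \sum_(i <- r | P i) hc n (F i).
Proof. exact: (big_morph (hc n) (hom_compD n) (hom_comp0 n)). Qed.

Lemma hom_compM_G i n u y : G i u ->
  hc n (u * y) = if (i <= n)%N then u * hc (n - i) y else 0.
Proof.
move=> Gu; apply: (hom_comp_eq
  (a := fun n => if (i <= n)%N then u * hc (n - i) y else 0)); split.
  move=> j; case: leqP => [ij|_]; last exact: G0.
  by rewrite -{1}(subnKC ij); apply: GM => //; exact: hom_compG.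
have [N hN] := hom_decomp_large (hom_compP y).
exists (i + N)%N; split=> [j ij|].
  rewrite (leq_trans (leq_addr _ _) ij).
  by have [|-> _] := hN (j - i)%N; [lia|rewrite mulr0].
have [_ {1}->] := hN N (leqnn N).
rewrite mulr_sumr big_split_ord /= [X in _ = X + _]big1 ?add0r => [|j _];
  last by rewrite leqNgt ltn_ord.
by apply: eq_bigr => j _; rewrite leq_addr addKn.
Qed.

Lemma hom_compZ n c x : hc n (c *: x) = c *: hc n x.
Proof. by rewrite -mulr_algl (hom_compM_G _ _ (G_alg c)) subn0 mulr_algl. Qed.

Lemma hom_compB n x y : hc n (x - y) = hc n x - hc n y.
Proof. by rewrite hom_compD -scaleN1r hom_compZ scaleN1r. Qed.

(** The guard is essential: for [i > n] the truncated [n - i] would wrongly select the component of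
    degree 0 of [y]. *)
Lemma hom_comp_sum_mul x y n : exists N,
  hc n (x * y) = \sum_(i < N) if (i <= n)%N then hc i x * hc (n - i) y else 0.
Proof.
have [_ [N [_ def_x]]] := hom_compP x; exists N.
rewrite {1}def_x mulr_suml hom_comp_sum; apply: eq_bigr => i _.
by rewrite (hom_compM_G _ _ (hom_compG i x)).
Qed.

Definition ge_deg n : set S := [set x | forall i, (i < n)%N -> hc i x = 0].

Lemma ge_degM i j x y : ge_deg i x -> ge_deg j y -> ge_deg (i + j) (x * y).
Proof.
move=> hx hy n nij; have [N ->] := hom_comp_sum_mul x y n.
apply: big1 => p _; case: leqP => // pn.
have [pi|ip] := ltnP p i; first by rewrite hx ?mul0r.
by rewrite hy ?mulr0 //; lia.
Qed.

Lemma ge_deg_ideal n : is_ideal (ge_deg n).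
Proof.
split=> [i _|u v hu hv i ni|a u hu]; first exact: hom_comp0.
  by rewrite hom_compD hu // hv // addr0.
by rewrite -[n]add0n; exact: ge_degM.
Qed.

Lemma G_ge_deg i n u : (n <= i)%N -> G i u -> ge_deg n u.
Proof.
move=> ni Gu j jn; rewrite (hom_comp_G _ Gu) ltn_eqF //; exact: leq_trans jn ni.
Qed.

Lemma ge_deg_sum_closed n x (K : set S) : K 0 ->
  (forall u v, K u -> K v -> K (u + v)) ->
  (forall i u, (n <= i)%N -> G i u -> K u) -> ge_deg n x -> K x.
Proof.
move=> K0 KD KG hx; have [_ [N [_ ->]]] := hom_compP x.
apply: (big_ind K) => // i _; have [ni|/hx ->//] := leqP n i.
by apply: (KG i) => //; exact: hom_compG.
Qed.

Lemma irrelevant_eq : irrelevant G = ge_deg 1.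
Proof.
apply/seteqP; split.
  apply: ideal_gen_min; first exact: ge_deg_ideal.
  by move=> u [n /= n0]; exact: G_ge_deg.
move=> x hx; have [I0 ID _] := ideal_gen_ideal (\bigcup_(n in [set n | (0 <
  n)%N]) G n).
apply: ge_deg_sum_closed hx => // i u i0 Gu.
by apply: sub_ideal_gen; exists i.
Qed.

Lemma hom_comp0_alg x : exists c, hc 0%N x = c%:A.
Proof.
have := hom_compG 0%N x; case: S_graded => _ _ _ -> _ [c _ <-]; by exists c.
Qed.

Lemma hom_comp0M x y : hc 0%N (x * y) = hc 0%N x * hc 0%N y.
Proof.
have [N hN] := hom_decomp_large (hom_compP x).
have [_ {1}->] := hN N.+1 (leqnSn N).
rewrite mulr_suml hom_comp_sum big_ord_recl /= (hom_compM_G _ _ (hom_compG 0%N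
  x)).
rewrite leqnn subn0 big1 ?addr0 // => i _.
by rewrite (hom_compM_G _ _ (hom_compG _ x)).
Qed.

Lemma irrelevantP x : irrelevant G x <-> hc 0%N x = 0.
Proof.
rewrite irrelevant_eq; split=> [->//|x0 i].
by rewrite ltnS leqn0 => /eqP ->.
Qed.

(** It is the kernel of the degree 0 component, which is multiplicative with values in the field
    [k]. *)
Lemma irrelevant_prime : is_prime (irrelevant G).
Proof.
split; first exact: ideal_gen_ideal.
  move/irrelevantP; rewrite -(scale1r 1) (hom_comp_G _ (G_alg 1)) /= scale1r.
  by move/eqP; rewrite oner_eq0.
move=> u v /irrelevantP; rewrite hom_comp0M.
have [c uc] := hom_comp0_alg u; have [c' vc] := hom_comp0_alg v.
rewrite uc vc -mulr_algl mulr1 -scalerAl mul1r scalerA => /eqP.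
rewrite scaler_eq0 oner_eq0 orbF mulf_eq0 => /orP[] /eqP c0.
  by left; apply/irrelevantP; rewrite uc c0 scale0r.
by right; apply/irrelevantP; rewrite vc c0 scale0r.
Qed.

(** A positive order cannot be the default value, so it is the degree of the lowest nonzero
    component. *)
Lemma ord_init x : (0 < ord G x)%N -> [/\ ge_deg (ord G x) x,
  G (ord G x) (init G x) & ge_deg (ord G x).+1 (x - init G x)].
Proof.
move=> a0; have hlt i : (i < ord G x)%N -> hc i x = 0.
  by move: a0; rewrite /ord; case: xgetP => // n _ [_ h] _; exact: h.
split=> //; first exact: hom_compG.
move=> i ia; rewrite hom_compB (hom_comp_G _ (hom_compG _ _)).
case: eqP => [->|/eqP ne]; first by rewrite subrr.
by rewrite subr0 hlt // ltn_neqAle ne.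
Qed.

Lemma ord_eq0 x : irrelevant G x -> ord G x = 0%N -> x = 0.
Proof.
move=> /irrelevantP x0; rewrite /ord; case: xgetP => [n -> [+ _] n0|noP _].
  by rewrite n0.
have hc0 n : hc n x = 0.
  elim/ltn_ind: n => n IH; apply: contrapT => nx; exact: (noP n).
by have [_ [N [_ ->]]] := hom_compP x; apply: big1.
Qed.

Section Local.
Hypothesis S_fg : fin_gen_algebra S.
Local Notation m := (irrelevant G).
Local Notation "a %:L" := (@to_loc S (~` m) a) (at level 2, format "a %:L").
Local Notation mL := (ext m m).

Lemma to_loc_sum (I : Type) (r : seq I) (P : pred I) (F : I -> S) :
  (\sum_(i <- r | P i) F i)%:L = \sum_(i <- r | P i) (F i)%:L.
Proof.
exact: (big_morph (@to_loc S (~` m)) (@to_locD S m) (@to_loc0 S m)).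
Qed.

(** Generation in degree 1 enters here: the elements whose degree [n] component lies in the [n]-th
    power for every [n] form a subalgebra containing [G 1]. *)
Lemma G_pow i u : G i u -> ideal_pow mL i u%:L.
Proof.
have idp n := ideal_pow_ideal mL n.
pose B : set S := [set a | forall n, ideal_pow mL n (hc n a)%:L].
suff Bu : B u by move=> Gu; have := Bu i; rewrite (hom_comp_G _ Gu) eqxx.
have : alg_gen (G 1%N) u by case: S_graded => _ _ _ _ ->.
apply; first split.
- move=> n; rewrite -(scale1r 1) (hom_comp_G _ (G_alg 1)).
  by case: n => //= n; case: (idp n.+1).
- by move=> c v Bv n; rewrite hom_compZ -mulr_algl to_locM; exact: ideal_mull.
- by move=> v w Bv Bw n; rewrite hom_compD to_locD; exact: ideal_add.
- move=> v w Bv Bw n; have [N ->] := hom_comp_sum_mul v w n.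
  rewrite to_loc_sum; apply: ideal_sum => // j _.
  case: leqP => jn; last by case: (idp n).
  by rewrite -(subnKC jn) addKn to_locM; exact: ideal_powM.
- move=> v Gv n; rewrite (hom_comp_G _ Gv).
  case: eqP => [->|_]; last by case: (idp n).
  rewrite -[_%:L]mulr1; apply: ideal_mul_mem => //; apply: mem_ext.
  by apply: sub_ideal_gen; exists 1%N.
Qed.

Lemma ext_ge_deg n : ext m (ge_deg n) = ideal_pow mL n.
Proof.
apply/seteqP; split.
  apply: ext_min => [|a]; first exact: ideal_pow_ideal.
  have idp := ideal_pow_ideal mL n.
  apply: (ge_deg_sum_closed (K := [set a | ideal_pow mL n a%:L])).
  - by case: idp.
  - by move=> u v hu hv /=; rewrite to_locD; exact: ideal_add.
  - by move=> i u ni Gu; apply: (ideal_pow_le ni); exact: G_pow.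
elim: n => [|n IH].
  have -> : ext m (ge_deg 0) = setT; last by [].
  by apply: ideal_one; [exact: ext_ideal|apply: (@mem_ext _ m _ 1)].
apply: (@subset_trans _ (ideal_mul mL (ext m (ge_deg n)))).
  by apply: ideal_gen_mono => _ [u [v [hu hv ->]]]; exists u, v; split=> //;
    exact: IH.
apply: ideal_mul_gen_sub; first exact: ext_ideal.
move=> _ _ [a ma <-] [b hb <-]; rewrite -to_locM; apply: mem_ext.
by rewrite irrelevant_eq in ma; exact: (ge_degM ma hb).
Qed.

(** Algebra generators stripped of their constant terms generate [m]: the elements [b] with [g b] in
    [J] form a subalgebra, because $g(uv) = v\,g(u) + u_0\,g(v)$, with $u_0$ the constant term. *)
Lemma ext_irrelevant_fg : exists us : seq (loc (~` m)), mL = ideal_gen [set`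
  us].
Proof.
case: S_fg => s alg_s; pose g a := a - hc 0%N a.
have [J idJ [gJ mJ]] : exists2 J : set S, is_ideal J &
    (forall a, a \in s -> J (g a)) /\ J = ideal_gen [set` map g s].
  exists (ideal_gen [set` map g s]); first exact: ideal_gen_ideal.
  by split=> // a sa; apply: sub_ideal_gen; rewrite /= map_f.
have defm : m = J.
  apply/seteqP; split.
    move=> a /irrelevantP a0; suff : J (g a) by rewrite /g a0 subr0.
    have alg_a : alg_gen [set` s] a by rewrite alg_s.
    apply: (alg_a [set b | J (g b)]) => //; split=> /=.
    - rewrite /g -(scale1r 1) (hom_comp_G _ (G_alg 1)) subrr; by case: idJ.
    - move=> c u Ju; rewrite /g hom_compZ -scalerBr -mulr_algl;
      exact: ideal_mull.
    - move=> u v Ju Jv; have -> : g (u + v) = g u + g v by rewrite /g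
      hom_compD; ring.
      exact: ideal_add.
    - move=> u v Ju Jv; rewrite (_ : g (u * v) = v * g u + hc 0%N u * g v).
        by apply: ideal_add => //; exact: ideal_mull.
      by rewrite /g hom_comp0M; ring.
  rewrite mJ; apply: ideal_gen_min; first exact: ideal_gen_ideal.
  move=> _ /mapP[a _ ->]; apply/irrelevantP.
  by rewrite hom_compB (hom_comp_G _ (hom_compG _ _)) subrr.
exists (map (@to_loc S (~` m)) (map g s)).
rewrite (congr1 (ext m) defm) mJ ext_ideal_gen; congr ideal_gen; apply/seteqP;
  split.
  by move=> _ [a sa <-] /=; exact: map_f.
by move=> _ /mapP[a sa ->]; exists a.
Qed.

Lemma finite_colength_mpow n : finite_colength (ideal_pow mL n).
Proof.
apply: finite_colength_pow; [exact: ext_ideal| |exact: ext_irrelevant_fg].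
by exists 1%N; apply: len_le_ext_max; exact: irrelevant_prime.
Qed.

Section SystemOfParams.
Variables (d : nat) (x : 'I_d -> S).
Hypothesis x_sop : sop G x.
Local Notation xL := (fun i => (x i)%:L).

Lemma ext_range (z : 'I_d -> S) :
  ext m (ideal_gen (range z)) = ideal_gen (range (fun i => (z i)%:L)).
Proof.
rewrite ext_ideal_gen; congr ideal_gen; apply/seteqP; split.
  by move=> _ [_ [i _ <-] <-]; exists i.
by move=> _ [i _ <-]; exists (z i) => //; exists i.
Qed.

Lemma sop_irrelevant i : m (x i).
Proof.
have [_ _ mM] := irrelevant_prime; have [_ rad] := x_sop.
have : mL (x i)%:L.
  rewrite -rad; exists 1%N; rewrite expr1; apply: mem_ext.
  by apply: sub_ideal_gen; exists i.
move=> /(ext_to_loc irrelevant_prime (ideal_gen_ideal _))[t nt].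
by case/mM.
Qed.

(** Finite generation is used twice: a power of the parameter ideal lies in the box ideal, hence so
    do powers of the finitely many generators of [mL]. *)
Lemma sop_box b : exists N, ideal_pow mL N `<=` box xL b.
Proof.
have [us def_mL] := ext_irrelevant_fg; have [_ rad] := x_sop.
have idb := box_ideal xL b.
pose xs := [seq (x i)%:L | i <- enum 'I_d].
have [|N hN] := @fg_radical_pow _ xs (box xL b) idb.
  by move=> _ /mapP[i _ ->]; exists b; apply: sub_ideal_gen; exists i.
rewrite def_mL; apply: fg_radical_pow => // u us_u.
have : radical (ext m (ideal_gen (range x))) u.
  by rewrite rad def_mL; exact: sub_ideal_gen.
case=> n; rewrite ext_range => hn; exists (n * N)%N; rewrite exprM.
apply: hN; have := @ideal_powX _ (ideal_gen [set` xs]) 1 (u ^+ n) N.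
rewrite mul1n; apply.
rewrite -[u ^+ n]mulr1; apply: ideal_mul_mem => //.
apply: ideal_gen_mono hn => _ [i _ <-]; exact/map_f/mem_enum.
Qed.

Lemma finite_box b : finite_colength (box xL b).
Proof.
by have [N h] := sop_box b;
  exact: finite_colength_sub h (finite_colength_mpow N).
Qed.

End SystemOfParams.

(** Descent from the local ring to graded relations. Locally a power of [mL] lies in the parameter
    ideal; clearing denominators puts [t * u] in the ideal of the [y i] with [t] outside [m], and
    the degree [l] component of [t * u] is [u] times the nonzero constant term of [t]. *)
Lemma sop_homogeneous d (y : 'I_d -> S) (a : 'I_d -> nat) : sop G y ->
  (forall i, G (a i) (y i)) ->
  exists c, forall l u, (c <= l)%N -> G l u -> exists s : 'I_d -> S,
    [/\ forall i, G (l - a i)%N (s i), forall i, (l < a i)%N -> s i = 0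
      & u = \sum_(i < d) y i * s i].
Proof.
move=> y_sop Gy; have [c hc_] := sop_box y_sop 1; exists c => l u cl Gu.
have : ext m (ideal_gen (range y)) u%:L.
  have := hc_ _ (ideal_pow_le cl (G_pow Gu)); rewrite ext_range.
  by apply: ideal_gen_mono => _ [i _ <-]; exists i; rewrite ?expr1.
move=> /(ext_to_loc irrelevant_prime (ideal_gen_ideal _))[t nt hut].
pose K : set S := [set e | exists s : 'I_d -> S, e = \sum_(i < d) y i * s i].
have [s def_ut] : K (t * u).
  apply: (ideal_gen_min _ _ hut).
    split.
    - by exists (fun=> 0); rewrite big1 // => i _; rewrite mulr0.
    - move=> _ _ [s ->] [s' ->]; exists (fun i => s i + s' i).
      by rewrite -big_split; apply: eq_bigr => i _; rewrite mulrDr.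
    - move=> e _ [s ->]; exists (fun i => e * s i).
      by rewrite mulr_sumr; apply: eq_bigr => i _; rewrite mulrCA.
  move=> _ [i _ <-]; exists (fun j => (j == i)%:R).
  rewrite (bigD1 i) //= eqxx mulr1 big1 ?addr0 // => j /negbTE ->.
  by rewrite mulr0.
have [e te] := hom_comp0_alg t.
have e0 : e != 0.
  by apply/eqP => e0; apply: nt; apply/irrelevantP; rewrite te e0 scale0r.
pose s' i := e^-1 *: (if (a i <= l)%N then hc (l - a i) (s i) else 0).
exists s'; split.
- by move=> i; apply: GZ; case: ifP => _; [exact: hom_compG|exact: G0].
- by move=> i li; rewrite /s' leqNgt li scaler0.
have := congr1 (hc l) def_ut.
rewrite mulrC (hom_compM_G _ _ Gu) leqnn subnn te hom_comp_sum.
rewrite -[u * _]mulrC mulr_algl => /(congr1 (fun v => e^-1 *: v)).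
rewrite scalerA mulVf // scale1r => ->; rewrite scaler_sumr.
apply: eq_bigr => i _; rewrite (hom_compM_G _ _ (Gy i)) /s' -scalerAr.
by case: ifP => //; rewrite mulr0.
Qed.

(** * Weighted ideals against powers of the maximal ideal *)

Section Comparison.
Variables (d : nat) (x : 'I_d -> S).
Hypothesis x_sop : sop G x.
Hypothesis inx_sop : sop G (fun i => init G (x i)).
Hypothesis ord_gt0 : forall i, (0 < ord G (x i))%N.
Local Notation xL := (fun i => (x i)%:L).

(** Weights are functions on all of [nat]; the value 1 beyond [d] keeps them positive everywhere. *)
Definition ord_weight j := if insub j is Some i then ord G (x i) else 1%N.

Lemma ord_weightE (i : 'I_d) : ord_weight i = ord G (x i).
Proof. by rewrite /ord_weight valK. Qed.

Lemma ord_weight_gt0 j : (0 < ord_weight j)%N.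
Proof. by rewrite /ord_weight; case: insubP. Qed.

Lemma wideal_sub_mpow n : wideal xL ord_weight n `<=` ideal_pow mL n.
Proof.
apply: wideal_sub_pow => i; rewrite ord_weightE -ext_ge_deg; apply: mem_ext.
by have [] := ord_init (ord_gt0 i).
Qed.

(* Replacing in x_i by x_i in a homogeneous relation only costs terms of higher
   degree, and high degrees are absorbed since x is a system of parameters. *)
Lemma mpow_sub_wideal : exists c, forall n,
  ideal_pow mL n `<=` wideal xL ord_weight (n - c).
Proof.
pose a i := ord G (x i).
have hy i := ord_init (ord_gt0 i).
have Gy i : G (a i) (init G (x i)) by have [] := hy i.
have [c hc_] := sop_homogeneous inx_sop Gy; exists c => n0.
have [nc|cn] := ltnP n0 c.
  by rewrite (_ : (n0 - c = 0)%N) ?wideal0 //; lia.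
have idw n := wideal_ideal xL ord_weight n.
have [N hN] := sop_box x_sop (n0 - c)%N.
have hNw n : (n <= n0 - c)%N -> ideal_pow mL N `<=` wideal xL ord_weight n.
  move=> nn0; apply: subset_trans hN _; apply: subset_trans.
    exact: box_sub_wideal ord_weight_gt0.
  by apply: ideal_gen_mono => _ [s [szs les ->]]; exists s; split=> //; lia.
(* Outer induction on the weight [n], inner induction on how far [l] lies below [N]. The term
   [x i * s i] lowers [n] and [l] by the same amount, which preserves [n + c <= l]; the error term
   keeps [n] and raises the degree, until [N] is reached and [hNw] applies. *)
have main n l u : (n <= n0 - c)%N -> (n + c <= l)%N -> G l u ->
    wideal xL ord_weight n u%:L.
  elim/ltn_ind: n l u => n IHn l u nn0.
  have [e Nle] : exists e, (N <= l + e)%N by exists N; rewrite leq_addl.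
  elim: e l u Nle => [|e IHe] l u Nle ncl Gu.
    apply: (hNw _ nn0); rewrite addn0 in Nle.
    exact: (ideal_pow_le Nle (G_pow Gu)).
  have [s [Gs s0 ->]] := hc_ l u (leq_trans (leq_addl _ _) ncl) Gu.
  rewrite to_loc_sum; apply: ideal_sum => // i _.
  have [li|il] := ltnP l (a i).
    by rewrite s0 // mulr0 to_loc0; case: (idw n).
  have -> : init G (x i) * s i = x i * s i + (-1) * ((x i - init G (x i)) * s
    i) by ring.
  rewrite to_locD to_locM [(-1 * _)%:L]to_locM; apply: (ideal_add (idw n)).
    (* If [x i] alone weighs more than [n], any multiple of it will do; otherwise the outer
       hypothesis applies to [s i] with weight [n - a i]. *)
    have [ain|nai] := leqP (a i) n; last first.
      apply: (@wideal_mulx _ _ xL ord_weight i n 0); last by rewrite wideal0.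
      by rewrite ord_weightE addn0 ltnW.
    apply: (@wideal_mulx _ _ xL ord_weight i n (n - a i)).
      by rewrite ord_weightE -/(a i); lia.
    have := ord_gt0 i; rewrite -/(a i) => ai0.
    by apply: (IHn _ _ (l - a i)%N) => //; lia.
  apply: (ideal_mull _ (idw n)).
  have hz : ge_deg l.+1 ((x i - init G (x i)) * s i).
    have [_ _ h1] := hy i; have h2 := G_ge_deg (leqnn _) (Gs i).
    have := ge_degM h1 h2; rewrite -/(a i); congr (ge_deg _ _); lia.
  apply: (ge_deg_sum_closed (K := [set v | wideal xL ord_weight n v%:L])) hz.
  - by case: (idw n).
  - by move=> v v' hv hv' /=; rewrite to_locD; exact: (ideal_add (idw n)).
  - by move=> j v lj Gv; apply: (IHe j) => //; lia.
rewrite -ext_ge_deg; apply: ext_min => // v.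
apply: (ge_deg_sum_closed (K := [set v | wideal xL ord_weight (n0 - c) v%:L])).
- by case: (idw (n0 - c)%N).
- by move=> w w' hw hw' /=; rewrite to_locD;
  exact: (ideal_add (idw (n0 - c)%N)).
- by move=> j w nj Gw; apply: (main _ j) => //; lia.
Qed.

End Comparison.
End Local.
End GradedAlgebra.

Theorem theorem1p3 (R : realType) (k : fieldType)
  (k_infinite : infinite_set [set: k])
  (S : comAlgType k) (G : nat -> set S)
  (S_graded : standard_graded G) (S_fg : fin_gen_algebra S)
  (d : nat) (d_gt0 : (0 < d)%N) (S_dim : krull_dim S d)
  (x : 'I_d -> S)
  (x_sop : sop G x)
  (inx_sop : sop G (fun i => init G (x i))) :
  multiplicity G R d (ideal_gen (range x)) =
    (\prod_(i < d) ord G (x i))%:R * multiplicity G R d (irrelevant G).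
Proof.
have fin b (_ : (0 < b)%N) := finite_box S_graded S_fg x_sop b.
rewrite /multiplicity ext_range // (hs_mult_gen R d_gt0 fin).
have [ord_gt0|] := pselect (forall i, (0 < ord G (x i))%N); last first.
  move=> /existsNP[i /negP]; rewrite -eqn0Ngt => /eqP ord0.
  have xi0 : x i = 0 := ord_eq0 S_graded (sop_irrelevant S_graded x_sop i) ord0.
  rewrite (bigD1 i) //= ord0 mul0n mul0r.
  by apply: (@box_rate0 _ _ _ _ d_gt0 fin i); rewrite xi0.
have [c hle] := mpow_sub_wideal S_graded S_fg x_sop inx_sop ord_gt0.
rewrite (hs_mult_wideal R d_gt0 fin (ord_weight_gt0 ord_gt0)
  (wideal_sub_mpow S_graded ord_gt0) hle).
rewrite (eq_bigr _ (fun i _ => ord_weightE G x i)) mulrC divfK //.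
by rewrite pnatr_eq0 -lt0n prodn_gt0.
Qed.
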